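(* Let $F$ be a field of characteristic $p>0$, let $V$ be an $F$-vector space with $\dim_F V=3$, and let $G\subset GL(V)$ be a finite $p$-group. Then $S(V)^G$ is a polynomial ring if and only if $G$ is generated by transvections.
   Context: $S(V)$ is the symmetric algebra of $V$ over $F$; $G$ acts on it by $F$-algebra automorphisms extending its action on $V$, and $S(V)^G=\{x\in S(V)\mid g(x)=x \text{ for all } g\in G\}$. ''Polynomial ring'' means a polynomial ring over $F$ (as a graded subalgebra, generated by algebraically independent homogeneous elements). A transvection is an element $\sigma\in GL(V)$ with $\operatorname{rank}(\sigma-1)=1$ and $(\sigma-1)^2=0$. The trivial group is regarded as generated by the empty set of transvections. *)

(* Defs.v *)
From HB Require Import structures.
From mathcomp Require Import all_boot all_order all_algebra.
From mathcomp Require Import finmap mpoly.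

Set Implicit Arguments.
Unset Strict Implicit.
Unset Printing Implicit Defensive.

Import GRing.Theory.
Local Open Scope ring_scope.

Section GeneralLinear.
Variables (F : fieldType) (V : vectType F).

Definition inGL (g : 'End(V)) : Prop :=
  exists h : 'End(V), (g \o h = \1)%VF /\ (h \o g = \1)%VF.

Definition GLsubgroup (H : 'End(V) -> Prop) : Prop :=
  [/\ forall g, H g -> inGL g,
      H \1%VF,
      forall g h, H g -> H h -> H (g \o h)%VF
    & forall g, H g -> H (g^-1)%VF].

Definition GLgenerated (T : 'End(V) -> Prop) (g : 'End(V)) : Prop :=
  forall H, GLsubgroup H -> (forall t, T t -> H t) -> H g.

Definition finite_pgroup (p : nat) (G : {fset 'End(V)}) : Prop :=
  GLsubgroup (fun g => g \in G) /\ p.-nat #|` G|.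

Definition transvection (s : 'End(V)) : Prop :=
  [/\ inGL s, \dim (limg (s - \1%VF)) = 1%N & ((s - \1) \o (s - \1))%VF = 0].

Definition generated_by_transvections (G : {fset 'End(V)}) : Prop :=
  exists2 T : 'End(V) -> Prop, (forall t, T t -> transvection t)
    & forall g, g \in G <-> GLgenerated T g.

End GeneralLinear.

Section SymmetricAlgebra.
Variables (F : fieldType) (V : vectType F).

(* S(V) in coordinates: the variables are the vectors of the library's chosen
   basis of V. Lemma Sym_universal shows that this is the symmetric algebra. *)
Definition Sym := {mpoly F[\dim {:V}]}.

Definition Sym_inj (v : V) : Sym :=
  \sum_(i < \dim {:V}) coord (vbasis {:V}) i v *: 'X_i.

(* The algebra endomorphism of S(V) that extends g; see Sym_act_inj. *)
Definition Sym_act (g : 'End(V)) (x : Sym) : Sym :=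
  x \mPo [tuple Sym_inj (g (vbasis {:V})`_i) | i < \dim {:V}].

Definition Sym_invariant (G : {fset 'End(V)}) (x : Sym) : Prop :=
  forall g, g \in G -> Sym_act g x = x.

Definition algebraically_independent (m : nat) (f : m.-tuple Sym) : Prop :=
  forall P : {mpoly F[m]}, P \mPo f = 0 -> P = 0.

(* The F-subalgebra A of S(V) is F[f_1, ..., f_m], with the f_i homogeneous and
   algebraically independent. As A lies in S(V), finitely many generators are
   no restriction. *)
Definition is_polynomial_ring (A : Sym -> Prop) : Prop :=
  exists (m : nat) (f : m.-tuple Sym),
    [/\ forall i, exists d : nat, tnth f i \is d.-homog for mdeg,
        algebraically_independent f
      & forall x : Sym, A x <-> exists P : {mpoly F[m]}, x = P \mPo f].

Lemma Sym_inj_is_linear : linear Sym_inj.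
Proof.
move=> a u v; rewrite /Sym_inj scaler_sumr -big_split /=.
by apply: eq_bigr => i _; rewrite linearP scalerDl scalerA.
Qed.

Lemma Sym_inj_basis (i : 'I_(\dim {:V})) : Sym_inj (vbasis {:V})`_i = 'X_i.
Proof.
rewrite /Sym_inj (bigD1 i) //= big1 => [|j neq_ji].
  by rewrite coord_free ?(basis_free (vbasisP _)) // eqxx scale1r addr0.
by rewrite coord_free ?(basis_free (vbasisP _)) // eq_sym (negPf neq_ji) scale0r.
Qed.

HB.instance Definition _ :=
  GRing.isLinear.Build F V Sym *:%R Sym_inj Sym_inj_is_linear.

Lemma Sym_act_inj (g : 'End(V)) (v : V) : Sym_act g (Sym_inj v) = Sym_inj (g v).
Proof.
rewrite {2}(coord_vbasis (memvf v)) !linear_sum /Sym_act {1}/Sym_inj linear_sum.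
apply: eq_bigr => i _ /=.
by rewrite comp_mpolyZ comp_mpolyXU nth_mktuple !linearZ.
Qed.

Lemma Sym_universal (A : comAlgType F) (f : {linear V -> A}) :
  exists2 phi : {lrmorphism Sym -> A}, (forall v, phi (Sym_inj v) = f v)
    & forall psi : {lrmorphism Sym -> A},
        (forall v, psi (Sym_inj v) = f v) -> psi =1 phi.
Proof.
pose h (i : 'I_(\dim {:V})) := f (vbasis {:V})`_i.
pose m : Sym -> A := mmap (in_alg A) h.
have mZ : scalable m by move=> c p; rewrite /m mmapZ /= mulr_algl.
pose phi : {lrmorphism Sym -> A} :=
  HB.pack m (GRing.RMorphism.on (mmap (in_alg A) h))
    (GRing.isScalable.Build F Sym A *:%R m mZ).
have phiX (i : 'I_(\dim {:V})) : m 'X_i = h i by rewrite /m mmapX mmap1U.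
exists phi => [v|psi psiE x].
  rewrite {2}(coord_vbasis (memvf v)) /Sym_inj !linear_sum.
  by apply: eq_bigr => i _; rewrite !linearZ /= phiX.
rewrite (mpolyE x) !linear_sum; apply: eq_bigr => k _.
rewrite !linearZ; congr (_ *: _); rewrite mpolyXE_id !rmorph_prod.
by apply: eq_bigr => i _; rewrite !rmorphXn /= phiX -Sym_inj_basis psiE.
Qed.

End SymmetricAlgebra.

(* Main.v *)
Require Import Defs.
From HB Require Import structures.
From mathcomp Require Import all_boot all_order all_algebra.
From mathcomp Require Import fingroup pgroup mxrepresentation mxabelem.
From mathcomp Require Import finmap mpoly ring.

Set Implicit Arguments.
Unset Strict Implicit.
Unset Printing Implicit Defensive.

Import GRing.Theory.
Local Open Scope ring_scope.

(** A finite p-group in characteristic p fixes a full flag, so V has a basis in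
    which every g in G acts by
<<
      x0 |-> x0,   x1 |-> x1 + a x0,   x2 |-> x2 + b x1 + c x0,
>>
    and G becomes a finite group of triples (a, b, c).  Since (g - 1)^2 maps x2
    to a b x0, the transvections in G are the elements other than 1 with a = 0
    or b = 0.  The elements with a = 0 and those with b = 0 form normal subgroups
    A and B, so G is generated by transvections exactly when G = A B
    ([generated_factored]).

    Suppose that G = A B.  The invariants are built one variable at a time: if
    F[t] is the ring of invariants so far and the new elements only move t_k, by
    adding polynomials in the other t_j, then replacing t_k by the product of its
    orbit gives the new ring of invariants ([orbit_step]).  If some element of A
    has b <> 0, take first the orbit product N of x2 under A.  The elements of B
    still move N, but commutators of A and B make A meet B in at least as many
    elements as there are values of a on B, and this provides enough factors x0
    in the displacement of N for an additive form of Hilbert 90 to correct N by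
    a polynomial in x0, x1 into an invariant W of B.  The orbit product Y of x1
    then gives the invariants F[x0, Y, W] ([invariants_mixed]).  If b = 0 on all
    of G, then G acts by adding multiples of x0 to x1 and x2, and a Euclidean
    algorithm on the degrees of two generators, one group element at a time,
    keeps the ring of invariants polynomial ([invariants_translations]).

    Conversely, let F[f] be the ring of invariants of G, with f algebraically
    independent.  By the first part the subgroup H = A B has a polynomial ring
    of invariants F[h], and f = phi(h), so that Jac(f) = E Jac(h) for a
    polynomial E.  Let theta be a polynomial whose stabilizer in G lies in H.
    Lagrange interpolation at theta^p, with coefficients in F[f], recovers each
    h_k from theta^p.  Differentiation kills all p-th powers, and it follows that E
    divides a product of powers of the differences theta - g theta, where g theta
    differs from theta ([jacobian_row]).
    For theta = x1 these differences are multiples of x0; when theta is the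
    orbit product of x2 under B they are prime to x0.  Hence E is a nonzero
    constant.  The map phi is then unramified at the value of h at the origin, so
    that h(x) and h(g x), which have the same image under phi and take the same
    value at the origin, agree.
    Thus every g in G fixes the invariants of H, and G = H
    ([polynomial_factored]). *)

(** * Substitution in polynomials *)

HB.lock Definition subst (F : fieldType) (m n : nat) (t : 'I_m -> {mpoly F[n]})
  (P : {mpoly F[m]}) : {mpoly F[n]} := P \mPo [tuple t i | i < m].

Section Substitution.
Variable F : fieldType.

Lemma substE m n (t : 'I_m -> {mpoly F[n]}) P :
  subst t P = P \mPo [tuple t i | i < m].
Proof. by rewrite unlock. Qed.

Section Morphism.
Variables (m n : nat) (t : 'I_m -> {mpoly F[n]}).

Fact subst_is_linear : linear (subst t).
Proof. by move=> a P Q; rewrite !substE linearP. Qed.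

Fact subst_is_monoid_morphism : monoid_morphism (subst t).
Proof. by split=> [|P Q]; rewrite !substE (rmorph1, rmorphM). Qed.

HB.instance Definition _ :=
  GRing.isLinear.Build F {mpoly F[m]} {mpoly F[n]} *:%R (subst t) subst_is_linear.
HB.instance Definition _ :=
  GRing.isMonoidMorphism.Build {mpoly F[m]} {mpoly F[n]} (subst t)
    subst_is_monoid_morphism.

Lemma substX i : subst t 'X_i = t i.
Proof. by rewrite substE comp_mpolyXU nth_mktuple. Qed.

Lemma substC c : subst t c%:MP = c%:MP.
Proof. by rewrite substE comp_mpolyC. Qed.

Lemma substD P Q : subst t (P + Q) = subst t P + subst t Q.
Proof. exact: raddfD. Qed.

Lemma substM P Q : subst t (P * Q) = subst t P * subst t Q.
Proof. exact: rmorphM. Qed.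

End Morphism.

Lemma subst_ext m n (t t' : 'I_m -> {mpoly F[n]}) : t =1 t' -> subst t =1 subst t'.
Proof.
by move=> tt' P; rewrite !substE; congr (_ \mPo _); apply: eq_mktuple.
Qed.

Lemma subst_id n (P : {mpoly F[n]}) : subst (fun i => 'X_i) P = P.
Proof. by rewrite substE comp_mpoly_id. Qed.

Lemma mderiv_var n (k i : 'I_n) : ('X_k : {mpoly F[n]})^`M(i) = (k == i)%:R.
Proof.
rewrite mderivX mnm1E; case: eqP => [->|_]; last by rewrite scale0r.
rewrite scale1r -mpolyX0; congr 'X_[_]; apply/mnmP => j.
by rewrite mnmBE mnm0E subnn.
Qed.

Lemma mpoly_alg_ind m (K : {mpoly F[m]} -> Prop) :
    (forall c, K c%:MP) -> (forall i, K 'X_i) ->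
    (forall P Q, K P -> K Q -> K (P + Q)) ->
    (forall P Q, K P -> K Q -> K (P * Q)) -> forall P, K P.
Proof.
move=> KC KX KD KM P; elim/mpolyind: P => [|c mon P _ _ KP]; first by rewrite -mpolyC0.
apply: (KD) => //; rewrite -mul_mpolyC; apply: (KM) => //.
rewrite mpolyXE_id; elim/big_ind: _ => // [|i _]; first by rewrite -mpolyC1.
elim: (mon i) => [|e IH]; first by rewrite expr0 -mpolyC1.
by rewrite exprS; apply: KM.
Qed.

Lemma subst_subst l m n (s : 'I_m -> {mpoly F[n]}) (t : 'I_l -> {mpoly F[m]}) P :
  subst s (subst t P) = subst (fun i => subst s (t i)) P.
Proof.
elim/mpoly_alg_ind: P => [c|i|P Q IP IQ|P Q IP IQ].
- by rewrite !substC.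
- by rewrite !substX.
- by rewrite !substD IP IQ.
- by rewrite !substM IP IQ.
Qed.

Lemma mderiv_subst m n (t : 'I_m -> {mpoly F[n]}) P i :
  (subst t P)^`M(i) = \sum_(j < m) subst t P^`M(j) * (t j)^`M(i).
Proof.
elim/mpoly_alg_ind: P => [c|k|P Q IP IQ|P Q IP IQ].
- by rewrite substC mderivC big1 // => j _; rewrite mderivC rmorph0 mul0r.
- rewrite substX (bigD1 k) //= big1 => [|j jk].
    by rewrite addr0 mderiv_var eqxx rmorph1 mul1r.
  by rewrite mderiv_var eq_sym (negPf jk) rmorph0 mul0r.
- rewrite substD mderivD IP IQ -big_split; apply: eq_bigr => j _ /=.
  by rewrite mderivD substD mulrDl.
rewrite substM mderivM IP IQ mulr_suml mulr_sumr -big_split; apply: eq_bigr => j _ /=.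
by rewrite mderivM substD !substM; ring.
Qed.

(** A polynomial Taylor formula of order one: the difference of two values is a
    combination of the differences of the arguments, and where the two arguments
    agree the coefficients are the partial derivatives. *)
Lemma subst_sub m n (s t : 'I_m -> {mpoly F[n]}) P (v : 'I_n -> F) :
    (forall j, (s j).@[v] = (t j).@[v]) ->
  exists2 q : 'I_m -> {mpoly F[n]},
    subst s P - subst t P = \sum_(j < m) q j * (s j - t j)
    & forall j, (q j).@[v] = (subst s P^`M(j)).@[v].
Proof.
move=> st; elim/mpoly_alg_ind: P => [c|k|P Q [q Eq Vq] [r Er Vr]|P Q [q Eq Vq] [r Er Vr]].
- exists (fun=> 0) => [|j]; last by rewrite mderivC !raddf0.
  by rewrite !substC subrr big1 // => j _; rewrite mul0r.
- exists (fun j => (j == k)%:R) => [|j].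
    rewrite !substX (bigD1 k) //= big1 => [|j /negPf->]; last by rewrite mul0r.
    by rewrite eqxx mul1r addr0.
  by rewrite mderiv_var eq_sym; case: eqP; rewrite ?rmorph1 ?raddf0.
- exists (fun j => q j + r j) => [|j]; last by rewrite mderivD substD !mevalD Vq Vr.
  rewrite !substD opprD addrACA Eq Er -big_split; apply: eq_bigr => j _ /=.
  by rewrite mulrDl.
have Vst S : (subst s S).@[v] = (subst t S).@[v].
  elim/mpoly_alg_ind: S => [c|i|S T IS IT|S T IS IT].
  - by rewrite !substC.
  - by rewrite !substX.
  - by rewrite !substD !mevalD IS IT.
  - by rewrite !substM !mevalM IS IT.
exists (fun j => q j * subst t Q + subst s P * r j) => [|j].
  transitivity ((subst s P - subst t P) * subst t Q + subst s P * (subst s Q - subst t Q)).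
    by rewrite !substM; ring.
  rewrite Eq Er mulr_suml mulr_sumr -big_split; apply: eq_bigr => j _ /=.
  by rewrite mulrDl mulrAC mulrA.
by rewrite mderivM substD !substM !mevalD !mevalM Vq Vr (Vst Q).
Qed.

End Substitution.

(** * Substituting for one variable *)

Section OneVariable.
Variables (F : fieldType) (n : nat).
Local Notation R := {mpoly F[n]}.

Definition upd m (t : 'I_m -> R) (k : 'I_m) (w : R) : 'I_m -> R :=
  fun i => if i == k then w else t i.

Definition subst_at (k : 'I_n) (w : R) : R -> R := subst (upd (fun i => 'X_i) k w).

Definition avoids (k : 'I_n) (P : R) := subst_at k 0 P = P.

Lemma upd_eq m (t : 'I_m -> R) k w : upd t k w k = w.
Proof. by rewrite /upd eqxx. Qed.

Lemma upd_neq m (t : 'I_m -> R) k w i : i != k -> upd t k w i = t i.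
Proof. by rewrite /upd => /negPf->. Qed.

Lemma subst_atX k w : subst_at k w 'X_k = w.
Proof. by rewrite /subst_at substX /upd eqxx. Qed.

Lemma subst_atXN k w i : i != k -> subst_at k w 'X_i = 'X_i.
Proof. by move=> ik; rewrite /subst_at substX /upd (negPf ik). Qed.

Lemma avoids_subst m k (s t : 'I_n -> {mpoly F[m]}) P :
  avoids k P -> (forall j, j != k -> s j = t j) -> subst s P = subst t P.
Proof.
move=> <- st; rewrite !subst_subst; apply: subst_ext => i; rewrite /upd.
by case: eqP => [_|/eqP ik]; rewrite ?raddf0 // !substX st.
Qed.

Lemma avoids_subst_at k w P : avoids k P -> subst_at k w P = P.
Proof.
move=> fP; rewrite -[RHS]fP; apply: (avoids_subst fP) => j jk.
by rewrite /upd (negPf jk).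
Qed.

Lemma avoids_X k i : i != k -> avoids k 'X_i.
Proof. by move=> ik; apply: subst_atXN. Qed.

Lemma avoids_D k P Q : avoids k P -> avoids k Q -> avoids k (P + Q).
Proof. by rewrite /avoids /subst_at substD => -> ->. Qed.

Lemma avoids_M k P Q : avoids k P -> avoids k Q -> avoids k (P * Q).
Proof. by rewrite /avoids /subst_at substM => -> ->. Qed.

Lemma avoids_N k P : avoids k P -> avoids k (- P).
Proof. by rewrite /avoids /subst_at raddfN /= => ->. Qed.

Lemma avoids_Z k c P : avoids k P -> avoids k (c *: P).
Proof. by rewrite /avoids /subst_at linearZ /= => ->. Qed.

Lemma avoids_subst_at0 k P : avoids k (subst_at k 0 P).
Proof.
rewrite /avoids /subst_at subst_subst; apply: subst_ext => i.
rewrite /upd; case: eqP => [_|/eqP ik]; first by rewrite raddf0.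
by rewrite substX (negPf ik).
Qed.

Lemma avoids_sum k (I : Type) (r : seq I) (E : I -> R) :
  (forall i, avoids k (E i)) -> avoids k (\sum_(i <- r) E i).
Proof.
by move=> fE; rewrite /avoids /subst_at raddf_sum; apply: eq_bigr => i _; apply: fE.
Qed.

Lemma avoids_prod k (I : Type) (r : seq I) (P : pred I) (E : I -> R) :
  (forall i, avoids k (E i)) -> avoids k (\prod_(i <- r | P i) E i).
Proof.
by move=> fE; rewrite /avoids /subst_at rmorph_prod; apply: eq_bigr => i _; apply: fE.
Qed.

Lemma avoids_Xn k P e : avoids k P -> avoids k (P ^+ e).
Proof. by rewrite /avoids /subst_at rmorphXn /= => ->. Qed.

(** The factor theorem, in the ring of polynomials in all the variables. *)
Lemma subst_at_factor k w P : exists Q, P - subst_at k w P = Q * ('X_k - w).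
Proof.
have [q Eq] : exists q : 'I_n -> R, subst (fun i => 'X_i) P - subst_at k w P
    = \sum_(j < n) q j * ('X_j - upd (fun i => 'X_i) k w j).
  elim/mpoly_alg_ind: P => [c|i|P Q [q Eq] [r Er]|P Q [q Eq] [r Er]].
  - by exists (fun=> 0); rewrite /subst_at !substC subrr big1 // => j _; rewrite mul0r.
  - exists (fun j => (j == i)%:R); rewrite /subst_at !substX (bigD1 i) //=.
    by rewrite big1 => [|j /negPf->]; rewrite ?mul0r // eqxx mul1r addr0.
  - exists (fun j => q j + r j); rewrite /subst_at !substD opprD addrACA Eq Er -big_split.
    by apply: eq_bigr => j _; rewrite mulrDl.
  exists (fun j => q j * subst_at k w Q + P * r j).
  transitivity ((P - subst_at k w P) * subst_at k w Q + P * (Q - subst_at k w Q)).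
    by rewrite subst_id /subst_at substM; ring.
  move: Eq Er; rewrite !subst_id => -> ->.
  rewrite mulr_suml mulr_sumr -big_split; apply: eq_bigr => j _ /=.
  by ring.
rewrite subst_id in Eq; exists (q k); rewrite Eq (bigD1 k) //= big1 => [|j jk].
  by rewrite addr0 /upd eqxx.
by rewrite /upd (negPf jk) subrr mulr0.
Qed.

Lemma msize_subst_at0 k P : (msize (subst_at k 0 P) <= msize P)%N.
Proof.
rewrite {1}(mpolyE P) /subst_at linear_sum /=; apply: leq_trans (msize_sum _ _ _) _.
apply/bigmax_leqP_seq => m mP _; rewrite linearZ /=.
apply: leq_trans (msizeZ_le _ _) _; apply: leq_trans (msize_mdeg_lt mP).
have -> : subst (upd (fun i => 'X_i) k 0) 'X_[m]
        = (if m k == 0 then 'X_[m] else 0) :> R.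
  rewrite mpolyXE_id rmorph_prod /=.
  case: eqP => [mk|/eqP mk].
    apply: eq_bigr => i _; rewrite rmorphXn /= substX /upd.
    by case: eqP => // ->; rewrite mk !expr0.
  by rewrite (bigD1 k) //= rmorphXn /= substX /upd eqxx expr0n (negPf mk) mul0r.
by case: ifP => _; rewrite ?msize0 ?msizeX.
Qed.

Lemma XD_neq0 k u : avoids k u -> 'X_k + u != 0.
Proof.
move=> fu; apply/eqP => /(congr1 (subst_at k (1 - u))).
rewrite /subst_at substD raddf0 -!/(subst_at _ _ _) subst_atX avoids_subst_at // subrK => /eqP.
by rewrite oner_eq0.
Qed.

(** The linear factors X_k + u are pairwise coprime: evaluating a multiple of
    one of them at the root of another leaves a nonzero factor u - w, which can be
    cancelled. *)
Lemma prod_dvd k (us : seq R) P : uniq us -> (forall u, u \in us -> avoids k u) ->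
  (forall u, u \in us -> subst_at k (- u) P = 0) ->
  exists Q, P = (\prod_(u <- us) ('X_k + u)) * Q.
Proof.
elim: us P => [|u us IH] P /=; first by exists P; rewrite big_nil mul1r.
move=> /andP[uNus Uus] fus Pu.
have [Q EQ] := subst_at_factor k (- u) P.
rewrite Pu ?mem_head // subr0 opprK in EQ.
have [w wus|w wus|Q' EQ'] := IH Q Uus.
- by apply: fus; rewrite inE wus orbT.
- have := Pu w; rewrite inE wus orbT => /(_ isT).
  rewrite EQ /subst_at substM substD -!/(subst_at _ _ _) subst_atX.
  rewrite (avoids_subst_at _ (fus u (mem_head _ _))).
  move/eqP; rewrite mulf_eq0 addrC subr_eq0 => /orP[/eqP //|/eqP uw].
  by rewrite uw wus in uNus.
by exists Q'; rewrite big_cons EQ EQ' mulrC mulrA.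
Qed.

Variables (k : 'I_n) (us : seq R).
Hypotheses (Uus : uniq us) (us0 : 0 \in us) (fus : forall u, u \in us -> avoids k u).
Let N : R := \prod_(u <- us) ('X_k + u).

Lemma msize_dvd_lt P Q : P = N * Q -> P != 0 -> (msize Q < msize P)%N.
Proof.
move=> -> nz; have /norP[N0 Q0] : ~~ ((N == 0) || (Q == 0)) by rewrite -mulf_eq0.
rewrite msizeM //; have Q1 : (0 < msize Q)%N by rewrite lt0n msize_poly_eq0.
suff N1 : (1 < msize N)%N
  by case: (msize N) N1 => [|[|l]] // _; rewrite addSn /= addSn ltnS leq_addl.
have EN : N = 'X_k * \prod_(u <- rem 0 us) ('X_k + u).
  by rewrite /N (perm_big _ (perm_to_rem us0)) big_cons addr0.
have /norP[X0 M0] : ~~ (('X_k == 0 :> R) || (\prod_(u <- rem 0 us) ('X_k + u) == 0)).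
  by rewrite -mulf_eq0 -EN.
rewrite EN msizeM // msizeX mdeg1 addSn /= add1n ltnS lt0n msize_poly_eq0.
exact: M0.
Qed.

Lemma subst_at0N : subst_at k 0 N = 0.
Proof.
rewrite /N (perm_big _ (perm_to_rem us0)) big_cons addr0 /subst_at substM.
by rewrite -/(subst_at _ _ _) subst_atX mul0r.
Qed.

(** An invariant P minus its value at X_k = 0 vanishes at X_k = 0, hence by
    invariance at X_k = - u for all u in the list; so it is a multiple of N, and the
    quotient is an invariant of smaller degree. *)
Lemma translation_invariants :
  (forall u, u \in us -> subst_at k ('X_k + u) N = N) ->
  forall P, (forall u, u \in us -> subst_at k ('X_k + u) P = P) ->
  exists Q, P = subst_at k N Q.
Proof.
move=> Ninv P; have [d] := ubnP (msize P).
elim: d P => // d IH P leP Pinv.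
pose P0 := subst_at k 0 P.
have fP0 : avoids k P0 by apply: avoids_subst_at0.
have [u uus|Q EQ] := @prod_dvd k us (P - P0) Uus fus.
  rewrite -{1}(Pinv u uus) {1}/subst_at raddfB /= -!/(subst_at _ _ _) (avoids_subst_at _ fP0).
  apply/eqP; rewrite subr_eq0; apply/eqP.
  rewrite /P0 /subst_at subst_subst; apply: subst_ext => i.
  have [->|ik] := eqVneq i k; last by rewrite !upd_neq // substX upd_neq.
  by rewrite !upd_eq substD -!/(subst_at _ _ _) subst_atX avoids_subst_at ?addNr //; apply: fus.
have NP : P = P0 + N * Q by rewrite -/N in EQ; rewrite -EQ addrC subrK.
have [Q0|Qn0] := eqVneq Q 0.
  by exists P0; rewrite (avoids_subst_at _ fP0) {1}NP Q0 mulr0 addr0.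
have N0 : N != 0.
  by rewrite /N prodf_seq_neq0; apply/allP => u uus /=; apply/XD_neq0/fus.
have NQ0 : N * Q != 0 by rewrite mulf_neq0.
have szQ : (msize Q < d)%N.
  apply: leq_trans (msize_dvd_lt (erefl _) NQ0) _.
  rewrite -[N * Q](_ : P - P0 = _); last by rewrite EQ.
  apply: leq_trans (msizeD_le _ _) _; rewrite mmeasureN geq_max.
  rewrite -ltnS (leq_trans _ leP) //=.
  by rewrite -ltnS (leq_trans _ leP) // ltnS; apply: msize_subst_at0.
have [u uus|Q' EQ'] := IH Q szQ.
  apply: (mulfI N0); rewrite -{1}(Ninv u uus).
  rewrite -[LHS](_ : subst_at k ('X_k + u) (N * Q) = _); last by rewrite /subst_at substM.
  by rewrite -EQ {1}/subst_at raddfB /= -!/(subst_at _ _ _) Pinv // (avoids_subst_at _ fP0).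
exists (P0 + 'X_k * Q').
by rewrite /subst_at substD substM -!/(subst_at _ _ _) subst_atX -EQ' (avoids_subst_at _ fP0).
Qed.

(** The product N vanishes at X_k = 0, so X_k divides any relation Q, and
    dividing by it gives a relation of smaller degree. *)
Lemma translation_alg_indep Q : subst_at k N Q = 0 -> Q = 0.
Proof.
have [d] := ubnP (msize Q); elim: d Q => // d IH Q leQ EQ.
have Q0 : subst_at k 0 Q = 0.
  transitivity (subst_at k 0 (subst_at k N Q)); last by rewrite EQ /subst_at raddf0.
  rewrite /subst_at subst_subst; apply: subst_ext => i.
  have [->|ik] := eqVneq i k; last by rewrite !upd_neq // substX upd_neq.
  by rewrite !upd_eq; apply/esym/subst_at0N.
have [Q' EQ'] := subst_at_factor k 0 Q; rewrite Q0 !subr0 in EQ'.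
have [->//|Qn0] := eqVneq Q 0.
have Qn0' : Q' != 0 by apply: contra_neq Qn0 => Q'0; rewrite EQ' Q'0 mul0r.
suff Q'0 : Q' = 0 by rewrite Q'0 eqxx in Qn0'.
have Xn0 : 'X_k != 0 :> R by apply: contra_neq Qn0 => X0; rewrite EQ' X0 mulr0.
apply: IH.
  rewrite -ltnS; apply: leq_trans leQ; rewrite EQ' msizeM // msizeX mdeg1 addn2 /=.
  by [].
have N0 : N != 0.
  by rewrite /N prodf_seq_neq0; apply/allP => u uus /=; apply/XD_neq0/fus.
apply: (mulfI N0); rewrite mulr0 -EQ EQ' /subst_at substM -!/(subst_at _ _ _).
by rewrite subst_atX mulrC.
Qed.

End OneVariable.

(** * Generators of rings of invariants *)

Lemma perm_map_stable (T : eqType) (f : T -> T) (s : seq T) :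
  injective f -> uniq s -> (forall x, x \in s -> f x \in s) ->
  perm_eq [seq f x | x <- s] s.
Proof.
move=> f_inj Us fs; have Ufs : uniq [seq f x | x <- s] by rewrite map_inj_uniq.
apply: uniq_perm => //.
have [||_ Es] := @uniq_min_size _ [seq f x | x <- s] s Ufs; last exact: Es.
  by move=> _ /mapP[x xs ->]; apply: fs.
by rewrite size_map.
Qed.

Section Steps.
Variables (F : fieldType) (n : nat).
Local Notation R := {mpoly F[n]}.

Definition alg_indep m (t : 'I_m -> R) := forall P, subst t P = 0 -> P = 0.

Definition generates m (A : R -> Prop) (t : 'I_m -> R) :=
  forall x, A x <-> exists P, x = subst t P.

Lemma alg_indep_inj m (t : 'I_m -> R) : alg_indep t -> injective (subst t).
Proof.
move=> ft P Q PQ; apply/eqP; rewrite -subr_eq0; apply/eqP/ft.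
by rewrite raddfB /= PQ subrr.
Qed.

Lemma subst_upd (t : 'I_n -> R) k w :
  subst (upd t k (subst t w)) =1 (fun P => subst t (subst_at k w P)).
Proof.
move=> P; rewrite /subst_at subst_subst; apply: subst_ext => i.
have [->|ik] := eqVneq i k; first by rewrite !upd_eq.
by rewrite !upd_neq // substX.
Qed.

Lemma subst_at_shiftK (k : 'I_n) (u : R) : avoids k u ->
  forall P, subst_at k ('X_k - u) (subst_at k ('X_k + u) P) = P.
Proof.
move=> fu P; rewrite /subst_at subst_subst -[RHS]subst_id; apply: subst_ext => i.
have [->|ik] := eqVneq i k; last by rewrite upd_neq // substX upd_neq.
by rewrite upd_eq substD -!/(subst_at _ _ _) subst_atX avoids_subst_at // subrK.
Qed.

(** A triangular change of generators is inverted by subtracting what was added. *)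
Lemma triangular_change A (t : 'I_n -> R) k u : avoids k u ->
  alg_indep t -> generates A t ->
  alg_indep (upd t k (t k + subst t u)) /\ generates A (upd t k (t k + subst t u)).
Proof.
move=> fu ft gt; have E : t k + subst t u = subst t ('X_k + u) by rewrite substD substX.
have K1 := subst_at_shiftK fu.
have K2 P : subst_at k ('X_k + u) (subst_at k ('X_k - u) P) = P.
  by have := subst_at_shiftK (avoids_N fu) P; rewrite opprK.
rewrite E; split=> [P|x].
  rewrite subst_upd => /ft EP; rewrite -(K1 P) EP /subst_at; exact: raddf0.
rewrite gt; split=> -[P ->].
  by exists (subst_at k ('X_k - u) P); rewrite subst_upd K2.
by exists (subst_at k ('X_k + u) P); rewrite subst_upd.
Qed.

(** The step from the invariants of a group (the predicate A) to those of a
    larger one (the predicate B).  By algebraic independence, [translation_invariants]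
    and [translation_alg_indep] can be applied to the polynomials in the
    generators t.  The list O is the orbit of t_k; each of its elements w comes
    with a substitution s that moves t_k to w and fixes the other generators.
    The substitution need only fix the invariants of the larger group and the
    orbit product, so that s may be any product of group elements. *)
Lemma orbit_step (A B : R -> Prop) (t : 'I_n -> R) (k : 'I_n) (O : seq R) :
    alg_indep t -> generates A t ->
    uniq O -> t k \in O ->
    (forall w, w \in O -> exists2 u, avoids k u & w = t k + subst t u) ->
    (forall w, w \in O -> exists2 s : 'I_n -> R,
       subst s (t k) = w /\ (forall j, j != k -> subst s (t j) = t j)
       & forall x, B x \/ x = \prod_(w <- O) w -> subst s x = x) ->
    (forall x, B x -> A x) ->
    (forall P, B (subst (upd t k (\prod_(w <- O) w)) P)) ->
  alg_indep (upd t k (\prod_(w <- O) w)) /\ generates B (upd t k (\prod_(w <- O) w)).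
Proof.
move=> ft gt UO tO Ou Os BA Bt; have it := alg_indep_inj ft.
have [us Eus fus] : exists2 us, [seq t k + subst t u | u <- us] = O
    & forall u, u \in us -> avoids k u.
  elim: O Ou {UO tO Os Bt} => [|w O IH] Ow; first by exists [::].
  have [us Eus fus] := IH (fun w' w'O => Ow w' (mem_behead (s := w :: O) w'O)).
  have [u fu Eu] := Ow w (mem_head _ _).
  exists (u :: us) => [|v]; first by rewrite /= Eus Eu.
  by rewrite inE => /orP[/eqP->//|/fus].
have Uus : uniq us by move: UO; rewrite -Eus => /map_uniq.
have us0 : 0 \in us.
  move: tO; rewrite -Eus => /mapP[u uus /eqP]; rewrite -subr_eq0 opprD addrA subrr.
  by rewrite add0r oppr_eq0 => /eqP /ft u0; rewrite u0 in uus.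
pose N : R := \prod_(u <- us) ('X_k + u).
have EN : \prod_(w <- O) w = subst t N.
  rewrite -Eus big_map rmorph_prod; apply: eq_bigr => u _ /=.
  by rewrite substD substX.
have shiftP P : B (subst t P) \/ P = N ->
    forall u, u \in us -> subst_at k ('X_k + u) P = P.
  move=> BP u uus; have [|s [sk sj] sB] := Os (t k + subst t u).
    by rewrite -Eus; apply: map_f.
  apply: it; rewrite -subst_upd.
  have <- : subst s (subst t P) = subst t P.
    by apply: sB; case: BP => [|->]; [left | right; rewrite EN].
  rewrite subst_subst; apply: subst_ext => j.
  have [->|jk] := eqVneq j k; first by rewrite upd_eq substD substX sk.
  by rewrite upd_neq // sj.
have Ninv := shiftP N (or_intror (erefl _)).
rewrite EN; split=> [P|x].
  by rewrite subst_upd => /ft; apply: translation_alg_indep.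
split=> [Bx|[P ->]]; last by rewrite -EN.
have /gt[P EP] := BA x Bx.
have [|Q EQ] := translation_invariants Uus us0 fus Ninv (P := P).
  by apply: shiftP; left; rewrite -EP.
by exists Q; rewrite subst_upd EP -EQ.
Qed.

End Steps.

(** * Additive polynomials *)

Section Additive.
Variable R : idomainType.
Implicit Types (U : seq R).

Definition nullpoly U : {poly R} := \prod_(u <- U) ('X + u%:P).

Lemma horner_nullpoly U s : (nullpoly U).[s] = \prod_(u <- U) (s + u).
Proof. by rewrite horner_prod; apply: eq_bigr => u _; rewrite !hornerE. Qed.

Lemma perm_shift U v : uniq U -> (forall u, u \in U -> u + v \in U) ->
  perm_eq [seq u + v | u <- U] U.
Proof. by apply: perm_map_stable; apply: addIr. Qed.

Lemma nullpoly_shift U u s : uniq U -> (forall v, v \in U -> v + u \in U) ->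
  (nullpoly U).[s + u] = (nullpoly U).[s].
Proof.
move=> UU Uu; rewrite !horner_nullpoly -[RHS](perm_big _ (perm_shift UU Uu)) big_map.
by apply: eq_bigr => v _; rewrite -addrA [u + v]addrC.
Qed.

(** As a polynomial in its argument, L(x + t) - L(x) - L(t) has degree smaller
    than the number of elements of U, and it vanishes at - u for all u in U. *)
Lemma nullpoly_additive U s t : uniq U -> 0 \in U ->
    {in U &, forall u v, u + v \in U} ->
  (nullpoly U).[s + t] = (nullpoly U).[s] + (nullpoly U).[t].
Proof.
move=> UU U0 UD; set L := nullpoly U.
have LU u : u \in U -> L.[- u] = 0.
  by move=> uU; rewrite horner_nullpoly (big_rem u) //= addNr mul0r.
have XpE v : 'X + v%:P = 'X - (- v)%:P :> {poly R} by rewrite polyCN opprK.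
have ELv v : \prod_(u <- U) ('X + (u + v)%:P)
    = \prod_(w <- [seq - (u + v) | u <- U]) ('X - w%:P) :> {poly R}.
  by rewrite big_map; apply: eq_bigr => u _; rewrite XpE.
pose D : {poly R} := \prod_(u <- U) ('X + (u + t)%:P) - L - L.[t]%:P.
have DE x : D.[x] = L.[x + t] - L.[x] - L.[t].
  rewrite /D !hornerE horner_prod [in RHS]horner_nullpoly; congr (_ - _ - _).
  by apply: eq_bigr => u _; rewrite hornerD hornerX hornerC [u + t]addrC addrA.
have szM v : (\prod_(u <- U) ('X + (u + v)%:P) : {poly R}) \is monic.
  by rewrite ELv monic_prod_XsubC.
have szD : (size D <= size U)%N.
  have sU : (0 < size U)%N by case: (U) U0.
  have sz v : size (\prod_(u <- U) ('X + (u + v)%:P) : {poly R}) = (size U).+1.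
    by rewrite ELv size_prod_XsubC size_map.
  have LE : L = \prod_(u <- U) ('X + (u + 0)%:P).
    by apply: eq_bigr => u _; rewrite addr0.
  apply: leq_trans (size_polyD _ _) _; rewrite size_polyN geq_max.
  rewrite (leq_trans (size_polyC_leq1 _) sU) andbT.
  apply/leq_sizeP => j; rewrite leq_eqVlt => /orP[/eqP<-|Uj].
    rewrite LE coefB.
    have := szM t; have := szM 0; rewrite !monicE /lead_coef !sz /= => /eqP-> /eqP->.
    by rewrite subrr.
  by rewrite LE coefB !nth_default ?sz ?subrr.
have D0 : D = 0.
  apply: (@roots_geq_poly_eq0 _ D [seq - u | u <- U]).
  - apply/allP => _ /mapP[u uU ->]; rewrite rootE DE LU // subr0 [- u + t]addrC.
    have := @nullpoly_shift U u (t - u) UU (fun v vU => UD v u vU uU).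
    by rewrite subrK -/L => ->; rewrite subrr.
  - by rewrite map_inj_uniq //; apply: oppr_inj.
  - by rewrite size_map.
have := DE s; rewrite D0 horner0 => /esym/eqP; rewrite -addrA -opprD subr_eq0 => /eqP->.
by [].
Qed.

(** The sum is the derivative of the additive polynomial with roots in U.  It is
    constant because its degree is smaller than the number of elements of U and
    it takes the same value at all of them. *)
Lemma sum_prod_const U s : uniq U -> 0 \in U -> {in U &, forall u v, u + v \in U} ->
    (forall u, u \in U -> - u \in U) ->
  \sum_(u <- U) \prod_(v <- U | v != u) (s + v) = \prod_(v <- U | v != 0) v.
Proof.
move=> UU U0 UD UN; set c := RHS.
pose E : {poly R} := \sum_(u <- U) \prod_(v <- U | v != u) ('X + v%:P) - c%:P.
have EE x : E.[x] = \sum_(u <- U) \prod_(v <- U | v != u) (x + v) - c.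
  rewrite /E !hornerE horner_sum; congr (_ - _); apply: eq_bigr => u _.
  by rewrite horner_prod; apply: eq_bigr => v _; rewrite !hornerE.
suff E0 : E = 0 by apply/eqP; rewrite -subr_eq0 -EE E0 horner0.
apply: (@roots_geq_poly_eq0 _ E U) => //; last first.
  apply: leq_trans (size_polyD _ _) _; rewrite size_polyN geq_max.
  rewrite (leq_trans (size_polyC_leq1 _)) ?andbT; last by case: (U) U0.
  apply: leq_trans (size_sum _ _ _) _; apply/bigmax_leqP_seq => u uU _.
  rewrite (eq_bigr (fun v : R => 'X - (- v)%:P)) => [|v _]; last by rewrite polyCN opprK.
  rewrite -big_filter -(big_map (fun v : R => - v) xpredT (fun v => 'X - v%:P)).
  rewrite size_prod_XsubC size_map size_filter.
  have := count_predC (pred1 u) U; rewrite count_uniq_mem // uU add1n => <-.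
  by [].
apply/allP => w wU; rewrite rootE EE subr_eq0; apply/eqP.
rewrite (bigD1_seq (- w)) ?UN //= [X in _ + X]big1_seq ?addr0 => [|u /andP[uw uU]].
  rewrite /c -[RHS](perm_big _ (perm_shift UU (fun u uU => UD u w uU wU))) big_map.
  by apply: eq_big => [v|v _] /=; [rewrite addr_eq0 | rewrite addrC].
by rewrite (big_rem (- w)) ?UN //= eq_sym uw subrr mul0r.
Qed.

End Additive.

(** * Divisibility of Jacobians *)

Section Jacobian.
Variables (F : fieldType) (p : nat) (n : nat).
Hypothesis charF : p \in [pchar F].
Local Notation R := {mpoly F[n]}.

Lemma pchar_mpoly : p \in [pchar R].
Proof.
rewrite inE (pcharf_prime charF) /=; apply/eqP.
by rewrite -mpolyC_nat (pcharf0 charF) mpolyC0.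
Qed.

Lemma mderiv_pow_p (x : R) i : (x ^+ p)^`M(i) = 0.
Proof.
have E m : (x ^+ m.+1)^`M(i) = x ^+ m * x^`M(i) *+ m.+1.
  elim: m => [|m IH]; first by rewrite expr1 expr0 mul1r.
  by rewrite exprS mderivM IH [RHS]mulrS exprS mulrnAr mulrA [x^`M(i) * _]mulrC.
have := E p.-1; rewrite prednK ?prime_gt0 ?(pcharf_prime charF) // => ->.
by rewrite -mulr_natl (pcharf0 pchar_mpoly) mul0r.
Qed.

(** The ring of invariants is F[f], and O is the orbit of the pair (theta, y).
    The Lagrange interpolation polynomial L, which sends the p-th power of w to
    a multiple of z for each pair (w, z) of the orbit, has invariant coefficients, hence
    coefficients in F[f].  Its value at theta^p is y times the p-th power on the
    left-hand side.  All p-th powers have derivative 0, so in the derivative of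
    this equation only y and the coefficients of L are differentiated, and the
    chain rule writes the latter in terms of the derivatives of f. *)
Lemma jacobian_row (m : nat) (K : ('I_n -> R) -> Prop) (f : 'I_m -> R)
    (O : seq (R * R)) (theta y : R) :
    (forall x, (forall s, K s -> subst s x = x) -> exists P, x = subst f P) ->
    (forall s, K s -> injective (subst s)) ->
    uniq O -> (theta, y) \in O ->
    (forall s o, K s -> o \in O -> (subst s o.1, subst s o.2) \in O) ->
  exists B : 'I_m -> R, forall i,
    (\prod_(o <- O | o != (theta, y)) (theta - o.1)) ^+ p * y^`M(i)
      = \sum_l B l * (f l)^`M(i).
Proof.
move=> gf Kinj UO Oy OK.
pose L : {poly R} := \sum_(o <- O) o.2%:P * \prod_(o' <- O | o' != o) ('X - (o'.1 ^+ p)%:P).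
have Linv s : K s -> map_poly (subst s) L = L.
  move=> Ks; pose so (o : R * R) := (subst s o.1, subst s o.2).
  have so_inj : injective so.
    move=> [a b] [c d] [/(Kinj s Ks)-> /(Kinj s Ks)->] //.
  have permO : perm_eq [seq so o | o <- O] O.
    by apply: perm_map_stable => // o; apply: OK.
  rewrite /L rmorph_sum -[RHS](perm_big _ permO) big_map; apply: eq_bigr => o _ /=.
  rewrite rmorphM /= map_polyC rmorph_prod -[in RHS](perm_big _ permO) big_map.
  congr (_ * _); apply: eq_big => [o'|o' _]; first by rewrite inj_eq.
  by rewrite rmorphB /= map_polyX map_polyC /= rmorphXn.
have [C EC] : exists C : 'I_(size L) -> {mpoly F[m]},
    forall k : 'I_(size L), L`_k = subst f (C k).
  have := @fin_all_exists _ (fun=> {mpoly F[m]})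
    (fun (k : 'I_(size L)) P => L`_k = subst f P).
  apply => k.
  by apply: gf => s Ks; rewrite -coef_map /= Linv.
set D := (\prod_(o <- O | _) _) ^+ p.
have ED : y * D = \sum_k subst f (C k) * (theta ^+ k) ^+ p.
  transitivity L.[theta ^+ p]; last first.
    by rewrite horner_coef; apply: eq_bigr => k _; rewrite EC exprAC.
  rewrite horner_sum (bigD1_seq (theta, y)) //= [X in _ + X]big1_seq ?addr0 => [|o /andP[oy oO]].
    rewrite hornerM hornerC horner_prod /D -prodrXl; congr (_ * _).
    apply: eq_bigr => o _; rewrite hornerXsubC.
    have := pFrobenius_autB_comm pchar_mpoly (mulrC theta o.1).
    by rewrite !pFrobenius_autE.
  rewrite hornerM horner_prod (eq_bigr _ (fun o' _ => hornerXsubC _ _)).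
  rewrite (big_rem (theta, y)) //= eq_sym oy (subrr (theta ^+ p)) mul0r.
  exact: mulr0.
exists (fun l => \sum_k subst f (C k)^`M(l) * (theta ^+ k) ^+ p) => i.
have /(congr1 (mderiv i)) := ED.
rewrite mderivM mderiv_pow_p mulr0 addr0 mulrC => ->.
rewrite linear_sum /=.
transitivity (\sum_k \sum_l subst f (C k)^`M(l) * (f l)^`M(i) * (theta ^+ k) ^+ p).
  by apply: eq_bigr => k _; rewrite mderivM mderiv_pow_p mulr0 addr0 mderiv_subst mulr_suml.
rewrite exchange_big; apply: eq_bigr => l _; rewrite mulr_suml.
by apply: eq_bigr => k _; rewrite mulrAC.
Qed.

End Jacobian.

(** * Counting algebraically independent polynomials *)

Section Count.
Variable F : fieldType.

Lemma msize_prod_le n (I : Type) (r : seq I) (E : I -> {mpoly F[n]}) (e : I -> nat) :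
  (forall i, msize (E i) <= (e i).+1)%N ->
  (msize (\prod_(i <- r) E i) <= (\sum_(i <- r) e i).+1)%N.
Proof.
move=> Ee; elim: r => [|i r IH]; first by rewrite !big_nil msize1.
rewrite !big_cons; have [->|n0] := eqVneq (E i * \prod_(j <- r) E j) 0.
  by rewrite msize0.
have /norP[E0 P0] : ~~ ((E i == 0) || (\prod_(j <- r) E j == 0)) by rewrite -mulf_eq0.
rewrite msizeM // -ltnS prednK; last by rewrite addn_gt0 lt0n msize_poly_eq0 E0.
 apply: leq_trans (leq_add (Ee i) IH) _.
by rewrite addSn addnS.
Qed.

(** The N^m monomials in f with exponents smaller than N are linearly independent,
    and they lie in the span of the monomials in n variables whose exponents
    are at most m N d. *)
Lemma alg_indep_count m n (f : 'I_m -> {mpoly F[n]}) (d N : nat) :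
    (forall i, msize (f i) <= d.+1)%N -> alg_indep f ->
  (N ^ m <= (m * (N * d)).+1 ^ n)%N.
Proof.
move=> df ft; set K := (m * (N * d)).+1.
pose mon (a : {ffun 'I_m -> 'I_N}) : 'X_{1..m} := [multinom (a i : nat) | i < m].
pose moe (a : {ffun 'I_n -> 'I_K}) : 'X_{1..n} := [multinom (a i : nat) | i < n].
pose M := \matrix_(i < #|{ffun 'I_m -> 'I_N}|, j < #|{ffun 'I_n -> 'I_K}|)
   (subst f 'X_[mon (enum_val i)])@_(moe (enum_val j)).
have szf a : (msize (subst f 'X_[mon a]) <= K)%N.
  rewrite mpolyXE_id rmorph_prod /=.
  apply: leq_trans (@msize_prod_le _ _ _ _ (fun=> N * d)%N _) _; last first.
    by rewrite big_const_ord iter_addn_0 mulnC.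
  move=> i; rewrite rmorphXn /= substX mnmE.
  have -> : f i ^+ a i = \prod_(0 <= j < a i) f i by rewrite prodr_const_nat subn0.
  apply: leq_trans (@msize_prod_le _ _ _ _ (fun=> d) _) _ => //.
  rewrite ltnS sum_nat_const_nat subn0 leq_mul2r; apply/orP; right.
  exact: ltnW.
suff rM : row_free M.
  have := rank_leq_col M; rewrite (eqP rM) !card_ffun !card_ord.
  by [].
rewrite -kermx_eq0; apply/rowV0P => v /sub_kermxP vM.
pose P := \sum_i v 0 i *: 'X_[F, mon (enum_val i)].
have coefP i : P@_(mon (enum_val i)) = v 0 i.
  rewrite /P linear_sum /= (bigD1 i) //= big1 => [|j ji].
    by rewrite addr0 mcoeffZ mcoeffX eqxx mulr1.
  rewrite mcoeffZ mcoeffX; case: eqP => [/mnmP e|]; last by rewrite mulr0.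
  case/eqP: ji; apply: enum_val_inj; apply/ffunP => k; apply: val_inj.
  by have := e k; rewrite !mnmE.
suff P0 : P = 0 by apply/rowP => i; rewrite mxE -coefP P0 mcoeff0.
apply: ft; apply/mpolyP => w; rewrite mcoeff0.
have [wK|] := boolP [forall i : 'I_n, w i < K]%N; last first.
  rewrite negb_forall => /existsP[i]; rewrite -leqNgt => Kw.
  apply: memN_msupp_eq0; apply: msize_mdeg_ge.
  rewrite /P linear_sum /=; apply: leq_trans (msize_sum _ _ _) _.
  apply/bigmax_leqP_seq => j _ _; rewrite linearZ /=.
  apply: leq_trans (msizeZ_le _ _) _; apply: leq_trans (szf _) _.
  by rewrite mdegE (bigD1 i) //= (leq_trans Kw) ?leq_addr.
pose a : {ffun 'I_n -> 'I_K} := [ffun i => inord (w i)].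
have -> : w = moe (enum_val (enum_rank a)).
  apply/mnmP => i; rewrite enum_rankK mnmE ffunE inordK //.
  exact: (forallP wK).
have /matrixP/(_ 0 (enum_rank a)) := vM.
rewrite !mxE => <-; rewrite /P !linear_sum /=; apply: eq_bigr => i _.
by rewrite linearZ /= mcoeffZ mxE.
Qed.

Lemma alg_indep_leq m n (f : 'I_m -> {mpoly F[n]}) : alg_indep f -> (m <= n)%N.
Proof.
move=> ft; rewrite leqNgt; apply/negP => nm.
pose d := (\max_i msize (f i))%N.
have df i : (msize (f i) <= d.+1)%N by rewrite leqW // /d (leq_bigmax i).
(* This N makes N^(n+1) exceed the bound (N (m d + 1))^n of the counting lemma. *)
pose N := ((m * d).+1 ^ n).+1.
have := alg_indep_count N df ft; rewrite leqNgt => /negP; apply.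
have Kle : ((m * (N * d)).+1 <= N * (m * d).+1)%N.
  by rewrite mulnCA mulnS addnC -addn1 leq_add.
have leX a b e : (a <= b -> a ^ e <= b ^ e)%N by case: e => // e; rewrite leq_exp2r.
apply: leq_ltn_trans (leX _ _ n Kle) _.
rewrite expnMn.
apply: leq_trans (_ : N ^ n.+1 <= _)%N; last by rewrite leq_pexp2l.
by rewrite expnS [(N * _)%N]mulnC ltn_pmul2l // expn_gt0.
Qed.

End Count.

(** * Homogeneous polynomials *)

Section Homog.
Variable F : fieldType.

Lemma homog_prod_seq n (I : eqType) (r : seq I) (P : pred I) (E : I -> {mpoly F[n]}) d :
  (forall i, i \in r -> E i \is d.-homog for mdeg) ->
  \prod_(i <- r | P i) E i \is (d * count P r)%N.-homog for mdeg.
Proof.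
elim: r => [|i r IH] hE; first by rewrite big_nil muln0 dhomog1.
have {}IH := IH (fun j jr => hE j (mem_behead (s := i :: r) jr)).
rewrite big_cons /=; case: ifP => // _.
by rewrite mulnDr muln1; apply: dhomogM => //; apply: hE; apply: mem_head.
Qed.

Lemma homog_sum_seq n (I : eqType) (r : seq I) (P : pred I) (E : I -> {mpoly F[n]}) d :
  (forall i, i \in r -> E i \is d.-homog for mdeg) ->
  \sum_(i <- r | P i) E i \is d.-homog for mdeg.
Proof. by move=> hE; rewrite big_seq_cond; apply: rpred_sum => i /andP[/hE]. Qed.

Lemma homog_subst m n (t : 'I_m -> {mpoly F[n]}) d P :
  (forall i, t i \is 1.-homog for mdeg) -> P \is d.-homog for mdeg ->
  subst t P \is d.-homog for mdeg.
Proof.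
move=> ht /dhomogP hP; rewrite (mpolyE P) linear_sum /=.
apply: homog_sum_seq => w /hP <-; rewrite linearZ; apply: dhomogZ.
rewrite mpolyXE_id rmorph_prod /= mdegE.
elim/big_rec2: _ => [|i e x _ hx]; first exact: dhomog1.
apply: dhomogM => //; rewrite rmorphXn /= substX.
by have := dhomogMn (w i) (ht i); rewrite mul1n.
Qed.

Lemma homog_X n (i : 'I_n) : ('X_i : {mpoly F[n]}) \is 1.-homog for mdeg.
Proof. by rewrite dhomogX; apply/eqP; exact: mdeg1. Qed.

End Homog.

Lemma prod_const_count (R : comNzRingType) (I : Type) (r : seq I) (P : pred I) (x : R) :
  \prod_(i <- r | P i) x = x ^+ count P r.
Proof. by rewrite big_const_seq iter_mulr_1. Qed.

(** * Unitriangular substitutions in three variables *)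

Section Unitriangular.
Variable F : fieldType.
Local Notation R := {mpoly F[3]}.

Definition i0 : 'I_3 := @Ordinal 3 0 isT.
Definition i1 : 'I_3 := @Ordinal 3 1 isT.
Definition i2 : 'I_3 := @Ordinal 3 2 isT.

Lemma I3_ind (P : 'I_3 -> Prop) : P i0 -> P i1 -> P i2 -> forall i, P i.
Proof.
by move=> P0 P1 P2 [[|[|[|]]] // lti];
   [move: P0 | move: P1 | move: P2]; congr P; apply: val_inj.
Qed.

Definition vec3 (T : Type) (x y z : T) (i : 'I_3) : T :=
  if val i is 0 then x else if val i is 1 then y else z.

Definition X0 : R := 'X_i0.
Definition X1 : R := 'X_i1.
Definition X2 : R := 'X_i2.

(** The triple (a, b, c) stands for the substitution X0 |-> X0, X1 |-> X1 + a X0,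
    X2 |-> X2 + b X1 + c X0; [gmul] and [ginv] are the group law and the inverse
    that make [act] a left action. *)
Definition triple := (F * F * F)%type.
Definition ga (g : triple) := g.1.1.
Definition gb (g : triple) := g.1.2.
Definition gc (g : triple) := g.2.
Definition dispX2 (g : triple) : R := gb g *: X1 + gc g *: X0.
Definition act (g : triple) : R -> R := subst (vec3 X0 (X1 + ga g *: X0) (X2 + dispX2 g)).
HB.instance Definition _ g := GRing.LRMorphism.copy (act g)
  (subst (vec3 X0 (X1 + ga g *: X0) (X2 + dispX2 g))).

Definition gmul (g h : triple) : triple := (ga g + ga h, gb g + gb h, gc g + gc h + ga g * gb h).
Definition ginv (g : triple) : triple := (- ga g, - gb g, - gc g + ga g * gb g).
Definition gone : triple := (0, 0, 0).

Lemma actX0 g : act g X0 = X0. Proof. exact: substX. Qed.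
Lemma actX1 g : act g X1 = X1 + ga g *: X0. Proof. exact: substX. Qed.
Lemma actX2 g : act g X2 = X2 + dispX2 g. Proof. exact: substX. Qed.

Lemma actD g x y : act g (x + y) = act g x + act g y.
Proof. exact: raddfD. Qed.

Lemma actZ g c x : act g (c *: x) = c *: act g x.
Proof. exact: linearZ. Qed.

Lemma actXn g x n : act g (x ^+ n) = act g x ^+ n.
Proof. exact: rmorphXn. Qed.

Lemma act_subst g m (t : 'I_m -> R) P : act g (subst t P) = subst (fun i => act g (t i)) P.
Proof. exact: subst_subst. Qed.

Lemma act_mul g h x : act g (act h x) = act (gmul g h) x.
Proof.
rewrite act_subst; apply: subst_ext; apply: I3_ind; rewrite /vec3 /=.
- exact: actX0.
- by rewrite linearD linearZ /= actX0 actX1 -addrA -scalerDl.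
rewrite /dispX2 !linearD !linearZ /= actX0 actX1 actX2 /dispX2 /= !scalerDr scalerA.
by rewrite -!mul_mpolyC !mpolyCD !mpolyCM; ring.
Qed.

Lemma act_one x : act gone x = x.
Proof.
rewrite -[RHS]subst_id; apply: subst_ext; apply: I3_ind;
by rewrite /vec3 /dispX2 /= ?scale0r ?addr0.
Qed.

Lemma gmulVg g : gmul (ginv g) g = gone.
Proof. by rewrite /gmul /ginv /gone /ga /gb /gc /=; congr (_, _, _); ring. Qed.

Lemma act_inj g : injective (act g).
Proof.
by move=> x y /(congr1 (act (ginv g))); rewrite !act_mul gmulVg !act_one.
Qed.

Definition ugroup (G : seq triple) :=
  [/\ gone \in G, {in G &, forall g h, gmul g h \in G} & {in G, forall g, ginv g \in G}].

Definition invs (G : seq triple) (x : R) := forall g, g \in G -> act g x = x.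

(** The condition G = A B, for the normal subgroups A and B of the elements with
    vanishing first, respectively second, entry: (0, b, c) lies in A and its
    quotient with an element (a, b, _) of G lies in B. *)
Definition factored (G : seq triple) :=
  forall g, g \in G -> exists c, (0, gb g, c) \in G.

Lemma invs_subst G m (t : 'I_m -> R) P : (forall i, invs G (t i)) -> invs G (subst t P).
Proof. by move=> tG g gG; rewrite act_subst; apply: subst_ext => i; apply: tG. Qed.

Lemma lin_inj b c b' c' :
  b *: X1 + c *: X0 = b' *: X1 + c' *: X0 -> b = b' /\ c = c'.
Proof.
move=> E; split.
  have /(congr1 (meval (vec3 0 1 0))) := E.
  by rewrite !mevalD !mevalZ !mevalXU /vec3 /= !mulr1 !mulr0 !addr0.
have /(congr1 (meval (vec3 1 0 0))) := E.
by rewrite !mevalD !mevalZ !mevalXU /vec3 /= !mulr1 !mulr0 !add0r.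
Qed.

Lemma scaleX0_inj : injective (fun c => c *: X0).
Proof.
move=> c c' E; have [] := @lin_inj 0 c 0 c'; last by [].
by rewrite !scale0r !add0r.
Qed.

Lemma X0_neq0 : X0 != 0.
Proof.
apply/eqP => E; suff /eqP : (1 : F) = 0 by rewrite oner_eq0.
by apply: scaleX0_inj; rewrite E !scaler0.
Qed.

End Unitriangular.

(** * Groups G = A B in which A does not lie in B *)

Section MixedGroup.
Variable F : fieldType.
Local Notation R := {mpoly F[3]}.
Local Notation X0 := (X0 F).
Local Notation X1 := (X1 F).
Local Notation X2 := (X2 F).
Local Notation triple := (triple F).

Variable G : seq triple.
Hypothesis ugG : ugroup G.

Let A := undup [seq g <- G | ga g == 0].
Let B := [seq g <- G | gb g == 0].
Let UA := [seq dispX2 g | g <- A].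
Let LA := nullpoly UA.
Let aa := undup [seq ga g | g <- B].

Let inA g : (g \in A) = (ga g == 0) && (g \in G).
Proof. by rewrite mem_undup mem_filter. Qed.

Let inB g : (g \in B) = (gb g == 0) && (g \in G).
Proof. by rewrite mem_filter. Qed.

Let dispX2_A_inj : {in A &, injective (@dispX2 F)}.
Proof.
move=> g h; rewrite !inA => /andP[/eqP ag _] /andP[/eqP ah _] /lin_inj[].
by case: g h ag ah => [[a b] c] [[a' b'] c']; rewrite /ga /gb /gc /= => -> -> -> ->.
Qed.

Let UUA : uniq UA.
Proof. by rewrite map_inj_in_uniq ?undup_uniq //; apply: dispX2_A_inj. Qed.

Let UAP b c : (b *: X1 + c *: X0 \in UA) = ((0, b, c) \in G).
Proof.
apply/mapP/idP => [[g gA]|bcG].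
  move=> /lin_inj[-> ->]; move: gA; rewrite inA => /andP[/eqP ag gG].
  by move: gG ag; case: g => [[a b'] c'] /[swap]; rewrite /ga /= => ->.
by exists (0, b, c) => //; rewrite inA bcG /ga eqxx.
Qed.

Let UAE u : u \in UA -> exists b c, u = b *: X1 + c *: X0.
Proof. by move=> /mapP[g _ ->]; exists (gb g), (gc g). Qed.

Let G0 : gone F \in G. Proof. by case: ugG. Qed.
Let GM g h : g \in G -> h \in G -> gmul g h \in G. Proof. by case: ugG => _ + _; apply. Qed.
Let GV g : g \in G -> ginv g \in G. Proof. by case: ugG => _ _; apply. Qed.

Let UA0 : 0 \in UA.
Proof. by have := UAP 0 0; rewrite !scale0r addr0 => ->. Qed.

Let UAD : {in UA &, forall u v, u + v \in UA}.
Proof.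
move=> u v uA vA; have [b [c Eu]] := UAE uA; have [b' [c' Ev]] := UAE vA.
rewrite Eu Ev addrACA -!scalerDl UAP.
move: uA vA; rewrite Eu Ev !UAP => uG vG; have := GM uG vG.
by rewrite /gmul /ga /gb /gc /= mul0r !addr0.
Qed.

Let UAN u : u \in UA -> - u \in UA.
Proof.
move=> uA; have [b [c Eu]] := UAE uA; rewrite Eu opprD -!scaleNr UAP.
by move: uA; rewrite Eu UAP => /GV; rewrite /ginv /ga /gb /gc /= oppr0 mul0r addr0.
Qed.

(** This is the normality of A in G. *)
Let UA_act g u : g \in G -> u \in UA -> act g u \in UA.
Proof.
move=> gG uA; have [b [c Eu]] := UAE uA.
rewrite Eu linearD !linearZ /= actX0 actX1 scalerDr scalerA -addrA -scalerDl UAP.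
move: uA; rewrite Eu UAP => uG; have := GM (GM gG uG) (GV gG).
congr (_ \in G); rewrite /gmul /ginv /ga /gb /gc /=; congr (_, _, _); ring.
Qed.

Let LA_act g x : g \in G -> act g LA.[x] = LA.[act g x].
Proof.
move=> gG; rewrite !horner_nullpoly rmorph_prod /=.
have P : perm_eq [seq act g u | u <- UA] UA.
  by apply: perm_map_stable (@act_inj _ g) UUA _ => u; apply: UA_act gG.
rewrite -[RHS](perm_big _ P) [RHS](big_map (act g)); apply: eq_bigr => u _.
by rewrite linearD.
Qed.

Let LAD s t : LA.[s + t] = LA.[s] + LA.[t].
Proof. exact: nullpoly_additive. Qed.

Let LA0 u : u \in UA -> LA.[u] = 0.
Proof.
by move=> uA; rewrite horner_nullpoly (big_rem (- u)) ?UAN //= subrr mul0r.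
Qed.

Let homL (x : R) : x \is 1.-homog for mdeg -> LA.[x] \is (size A).-homog for mdeg.
Proof.
move=> hx; rewrite horner_nullpoly -[size A]mul1n -(size_map (@dispX2 F)) -count_predT.
apply: homog_prod_seq => u /UAE[b [c ->]]; apply: rpredD => //.
by apply: rpredD; apply: dhomogZ; apply: homog_X.
Qed.

Let N := LA.[X2].

Let NA : invs A N.
Proof.
move=> g gA; have gG : g \in G by move: gA; rewrite inA => /andP[].
rewrite /N LA_act // actX2 LAD (@LA0 (dispX2 g)) ?addr0 //.
by apply/mapP; exists g.
Qed.

Let t1 := upd (fun i => 'X_i) i2 N.

Let ON : \prod_(w <- [seq X2 + u | u <- UA]) w = N.
Proof. by rewrite big_map /N horner_nullpoly. Qed.

Let gen1 : alg_indep t1 /\ generates (invs A) t1.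
Proof.
have Afix g j : g \in A -> j != i2 -> act g 'X_j = 'X_j.
  rewrite inA => /andP[/eqP ag _]; move: j; apply: I3_ind => // _.
    exact: actX0.
  by rewrite [LHS]actX1 ag scale0r addr0.
rewrite /t1 -ON; apply: (@orbit_step _ _ (fun=> True)).
- by move=> P; rewrite subst_id.
- by move=> x; split=> // _; exists x; rewrite subst_id.
- by rewrite map_inj_uniq //; apply: addrI.
- by apply/mapP; exists 0; rewrite ?addr0.
- move=> _ /mapP[u /UAE[b [c ->]] ->]; exists (b *: X1 + c *: X0).
    by apply: avoids_D; apply: avoids_Z; apply: avoids_X.
  by rewrite subst_id.
- move=> _ /mapP[_ /mapP[g gA ->] ->].
  exists (vec3 X0 (X1 + ga g *: X0) (X2 + dispX2 g)) => [|x Bx].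
    by split=> [|j j2]; [apply: actX2 | apply: Afix].
  by rewrite -/(act g x); case: Bx => [|->]; [apply | rewrite ON NA].
- by [].
rewrite ON => P; apply: invs_subst => i g gA; have [->|ik] := eqVneq i i2.
  by rewrite upd_eq NA.
by rewrite upd_neq // Afix.
Qed.

Let aaP a : reflect (exists c, (a, 0, c) \in G) (a \in aa).
Proof.
rewrite mem_undup; apply: (iffP mapP) => [[g]|[c acG]].
  rewrite inB => /andP[/eqP gb0 gG] ->; exists (gc g).
  by move: gG gb0; case: g => [[a' b] c'] /[swap]; rewrite /gb /= => ->.
by exists (a, 0, c) => //; rewrite inB acG /gb eqxx.
Qed.

Let Uaa : uniq aa. Proof. exact: undup_uniq. Qed.

Let aa0 : 0 \in aa. Proof. by apply/aaP; exists 0. Qed.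

Let aaD : {in aa &, forall a b, a + b \in aa}.
Proof.
move=> a a' /aaP[c acG] /aaP[c' acG']; apply/aaP; exists (c + c').
by have := GM acG acG'; rewrite /gmul /ga /gb /gc /= mulr0 !addr0.
Qed.

Let aaN a : a \in aa -> - a \in aa.
Proof.
move=> /aaP[c acG]; apply/aaP; exists (- c).
by have := GV acG; rewrite /ginv /ga /gb /gc /= mulr0 addr0 oppr0.
Qed.

Let Ua := [seq a *: X0 | a <- aa].

Let UUa : uniq Ua. Proof. by rewrite map_inj_uniq //; apply: scaleX0_inj. Qed.

Let UaP a : (a *: X0 \in Ua) = (a \in aa).
Proof. exact: (mem_map (@scaleX0_inj F)). Qed.

Let Ua0 : 0 \in Ua. Proof. by rewrite -(scale0r X0) UaP. Qed.

Let UaD : {in Ua &, forall u v, u + v \in Ua}.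
Proof.
by move=> _ _ /mapP[a aA ->] /mapP[b bA ->]; rewrite -scalerDl UaP aaD.
Qed.

Let UaN u : u \in Ua -> - u \in Ua.
Proof. by move=> /mapP[a aA ->]; rewrite -scaleNr UaP aaN. Qed.

(** For a value a of B, a choice of c with (a, 0, c) in G. *)
Let lift_a a := head 0 [seq gc g | g <- B & ga g == a].

Let lift_aP a : a \in aa -> (a, 0, lift_a a) \in G.
Proof.
move=> /aaP[c acG].
have : lift_a a \in [seq gc g | g <- B & ga g == a].
  have : c \in [seq gc g | g <- B & ga g == a].
    apply/mapP; exists (a, 0, c) => //.
    by rewrite mem_filter inB /ga /gb /= !eqxx acG.
  by rewrite /lift_a; case: [seq _ | _ <- _ & _] => //= ? ? _; apply: mem_head.
move=> /mapP[[[a' b'] c']]; rewrite mem_filter inB /ga /gb /gc /=.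
by move=> /andP[/eqP -> /andP[/eqP -> gG]] ->.
Qed.

Let cardC := count (fun g => gb g == 0) A.

(** The commutator of (a, 0, _) with a fixed (0, b, _) is (0, 0, a b). *)
Let size_aa_le : (exists2 h, h \in A & gb h != 0) -> (size aa <= cardC)%N.
Proof.
move=> [[[x b] c]]; rewrite inA /ga /gb /= => /andP[/eqP-> hG] b0.
rewrite /cardC -size_filter -(size_map (fun a : F => (0, 0, a * b) : triple)).
apply: uniq_leq_size; first by rewrite map_inj_uniq // => a a' [] /(mulIf b0).
move=> _ /mapP[a /aaP[c' aG] ->]; rewrite mem_filter inA /ga /gb /= !eqxx /=.
have := GM (GM aG hG) (GV (GM hG aG)).
congr (_ \in G); rewrite /gmul /ginv /ga /gb /gc /=; congr (_, _, _); ring.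
Qed.

(** The displacement of N under (a, 0, c) is [shiftN c]; the elements (0, 0, c') of
    A contribute linear factors that are multiples of X0, and [shiftN_quo c] is
    the quotient by a power of X0. *)
Let shiftN c := LA.[c *: X0].
Let shiftN_quo c := X0 ^+ (cardC - (size aa).-1) * (\prod_(g <- A | gb g == 0) (c + gc g))%:MP
              * \prod_(g <- A | gb g != 0) (c *: X0 + dispX2 g).

Let shiftNE c : ((size aa).-1 <= cardC)%N -> shiftN c = X0 ^+ (size aa).-1 * shiftN_quo c.
Proof.
move=> le; rewrite /shiftN horner_nullpoly big_map (bigID (fun g => gb g == 0)) /=.
rewrite /shiftN_quo !mulrA -exprD subnKC //; congr (_ * _).
rewrite (eq_bigr (fun g => X0 * (c + gc g)%:MP)) => [|g /eqP g0].
  by rewrite big_split /= prod_const_count rmorph_prod.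
by rewrite /dispX2 g0 scale0r add0r -scalerDl -mul_mpolyC mulrC.
Qed.

Let shiftND c c' : shiftN (c + c') = shiftN c + shiftN c'.
Proof. by rewrite /shiftN scalerDl LAD. Qed.

Let shiftNB c c' : shiftN (c - c') = shiftN c - shiftN c'.
Proof. by have := shiftND (c - c') c'; rewrite subrK => ->; rewrite addrK. Qed.

Let shiftN0 c : (0, 0, c) \in G -> shiftN c = 0.
Proof. by move=> cG; apply: LA0; have := UAP 0 c; rewrite scale0r add0r cG. Qed.

Let prod_but a := \prod_(v <- Ua | v != a *: X0) (X1 + v).

(** The additive Hilbert 90: the action of B permutes the products [prod_but a],
    whose sum is [tau] times a power of X0, and the displacement of N is an additive
    function of g in B.  With the weights [shiftN_quo], from which that power of X0
    has been divided out, g in B moves P by - [tau] times the displacement of N. *)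
Let P := \sum_(a <- aa) shiftN_quo (lift_a a) * prod_but a.

Let tau := \prod_(a <- aa | a != 0) a.

Let tau0 : tau != 0.
Proof. by rewrite /tau prodf_seq_neq0; apply/allP => a _; apply/implyP. Qed.

Let count_but_one (T : eqType) (r : seq T) a : uniq r -> a \in r ->
  count (fun v => v != a) r = (size r).-1.
Proof.
by move=> Ur ar; have := count_predC (pred1 a) r; rewrite count_uniq_mem // ar add1n => <-.
Qed.

Let sum_prod_but : \sum_(a <- aa) prod_but a = tau *: X0 ^+ (size aa).-1.
Proof.
rewrite -(big_map (fun a => a *: X0) xpredT (fun u => \prod_(v <- Ua | v != u) (X1 + v))).
rewrite sum_prod_const // big_map.
rewrite (eq_bigl (fun a => a != 0)) => [|a]; last by rewrite scaler_eq0 (negPf (X0_neq0 F)) orbF.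
rewrite (eq_bigr (fun a => a%:MP * X0)) => [|a _]; last by rewrite mul_mpolyC.
by rewrite big_split /= prod_const_count count_but_one // -rmorph_prod mul_mpolyC.
Qed.

Let prod_butE a : prod_but a = \prod_(b <- aa | b != a) (X1 + b *: X0).
Proof. by rewrite /prod_but big_map; apply: eq_bigl => b; rewrite (inj_eq (@scaleX0_inj F)). Qed.

Let B_aa g : g \in B -> ga g \in aa.
Proof. by move=> gB; rewrite mem_undup map_f. Qed.

Let shift_aa g : g \in B -> perm_eq [seq a + ga g | a <- aa] aa.
Proof. by move=> gB; apply: perm_shift => // a aA; apply: aaD => //; apply: B_aa. Qed.

Let act_prod_but g a : g \in B -> act g (prod_but a) = prod_but (a + ga g).
Proof.
move=> gB; rewrite !prod_butE rmorph_prod /=.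
rewrite -[RHS](perm_big _ (shift_aa gB)) big_map.
apply: eq_big => [b|b _]; first by rewrite (inj_eq (addIr _)).
by rewrite linearD linearZ /= actX0 actX1 scalerDl -addrA [ga g *: _ + _]addrC.
Qed.

Hypothesis A_mixed : exists2 h, h \in A & gb h != 0.

(** The displacement itself is fixed because G permutes UA, and the power of X0
    can be cancelled. *)
Let act_shiftN_quo g c : g \in G -> act g (shiftN_quo c) = shiftN_quo c.
Proof.
move=> gG; have le : ((size aa).-1 <= cardC)%N by rewrite (leq_trans (leq_pred _)) ?size_aa_le.
apply: (mulfI (expf_neq0 (size aa).-1 (X0_neq0 F))); rewrite -shiftNE //.
rewrite -{1}(actX0 g) -rmorphXn -rmorphM /= -shiftNE //.
by rewrite /shiftN LA_act // linearZ /= actX0.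
Qed.

Let act_P g : g \in B -> act g P = P - tau *: shiftN (gc g).
Proof.
move=> gB; have gG : g \in G by move: gB; rewrite inB => /andP[].
have le : ((size aa).-1 <= cardC)%N by rewrite (leq_trans (leq_pred _)) ?size_aa_le.
apply: (mulfI (expf_neq0 (size aa).-1 (X0_neq0 F))).
have EP : X0 ^+ (size aa).-1 * P = \sum_(a <- aa) shiftN (lift_a a) * prod_but a.
  by rewrite mulr_sumr; apply: eq_bigr => a _; rewrite mulrA -shiftNE.
rewrite mulrBr EP.
transitivity (\sum_(a <- aa) (shiftN (lift_a (a + ga g)) - shiftN (gc g)) * prod_but (a + ga g)).
  rewrite /P rmorph_sum mulr_sumr /= big_seq [RHS]big_seq.
  apply: eq_bigr => a aA; rewrite rmorphM /= act_shiftN_quo // act_prod_but // mulrA -shiftNE //.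
  congr (_ * _); apply/eqP; rewrite eq_sym subr_eq -shiftND -subr_eq0 -shiftNB; apply/eqP.
  (* Both (a, 0, lift_a a) times g and (a + ga g, 0, lift_a (a + ga g)) lie in B,
     and their quotient (0, 0, _) does not move N. *)
  have gE : g = (ga g, 0, gc g).
    by move: gB; rewrite inB => /andP[/eqP + _]; case: (g) => [[a' b'] c']; rewrite /gb /= => ->.
  have aG := lift_aP aA; have agG := lift_aP (aaD aA (B_aa gB)).
  have := GM (GM aG gG) (GV agG); rewrite {1}gE.
  rewrite /gmul /ginv /ga /gb /gc /= !(mulr0, oppr0, addr0) subrr => /shiftN0.
  by move=> E; apply/eqP; rewrite shiftNB subr_eq0 eq_sym -subr_eq0 -shiftNB E.
transitivity (\sum_(b <- [seq a + ga g | a <- aa])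
    (shiftN (lift_a b) - shiftN (gc g)) * prod_but b).
  by rewrite big_map; apply: eq_bigr.
rewrite (perm_big _ (shift_aa gB)) /=.
rewrite (eq_bigr (fun a => shiftN (lift_a a) * prod_but a
    - shiftN (gc g) * prod_but a)) => [|a _]; last first.
  by rewrite mulrBl.
by rewrite sumrB -mulr_sumr sum_prod_but -!scalerAr mulrC.
Qed.

Let W := N + tau^-1 *: P.

Let avoids_lin b c : avoids i2 (b *: X1 + c *: X0).
Proof. by apply: avoids_D; apply: avoids_Z; apply: avoids_X. Qed.

Let avoids_P : avoids i2 P.
Proof.
apply: avoids_sum => a; apply: avoids_M; last first.
  rewrite prod_butE; apply: avoids_prod => b.
  by apply: avoids_D; [|apply: avoids_Z]; apply: avoids_X.
apply: avoids_M; last first.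
  by apply: avoids_prod => g; rewrite addrC /dispX2 -addrA -scalerDl; apply: avoids_lin.
apply: avoids_M; first by apply: avoids_Xn; apply: avoids_X.
by rewrite /avoids /subst_at substC.
Qed.

Let fixA g x : g \in A -> avoids i2 x -> act g x = x.
Proof.
rewrite inA => /andP[/eqP ag _] fx; rewrite -[RHS]subst_id; apply: (avoids_subst fx).
by apply: I3_ind => // _; rewrite /vec3 /= ag scale0r addr0.
Qed.

Let WAB g : g \in A ++ B -> act g W = W.
Proof.
rewrite mem_cat => /orP[gA|gB]; rewrite /W linearD linearZ /=.
  by rewrite NA // fixA.
have gG : g \in G by move: gB; rewrite inB => /andP[].
have -> : act g N = N + shiftN (gc g).
  rewrite /N LA_act // actX2 LAD /shiftN.
  by move: gB; rewrite inB /dispX2 => /andP[/eqP-> _]; rewrite scale0r add0r.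
rewrite act_P // scalerBr scalerA mulVf ?tau0 // scale1r.
by rewrite -addrA [shiftN _ + _]addrC subrK.
Qed.

Let gen2 : alg_indep (vec3 X0 X1 W) /\ generates (invs A) (vec3 X0 X1 W).
Proof.
have [i1 g1] := gen1.
have [] := triangular_change (avoids_Z tau^-1 avoids_P) i1 g1.
have E : upd t1 i2 (t1 i2 + subst t1 (tau^-1 *: P)) =1 vec3 X0 X1 W.
  have -> : t1 i2 + subst t1 (tau^-1 *: P) = W.
    rewrite /t1 upd_eq -/(subst_at i2 N _) avoids_subst_at //; exact: avoids_Z.
  by apply: I3_ind; rewrite ?upd_eq // /t1 !upd_neq.
move=> i2 g2; split=> [Q EQ|x]; first by apply: i2; rewrite (subst_ext E).
by rewrite g2; split=> -[Q ->]; exists Q; rewrite (subst_ext E).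
Qed.

Let Y := (nullpoly Ua).[X1].

Let YAB g : g \in A ++ B -> act g Y = Y.
Proof.
rewrite mem_cat => gAB; have gaa : ga g \in aa.
  by case/orP: gAB => [|/B_aa//]; rewrite inA => /andP[/eqP->].
rewrite /Y -[RHS](@nullpoly_shift _ _ (ga g *: X0)) //; last first.
  by move=> v vU; apply: UaD; rewrite ?UaP.
rewrite !horner_nullpoly rmorph_prod big_map [RHS]big_map; apply: eq_bigr => a _.
by rewrite /= linearD linearZ /= actX0 actX1.
Qed.

Let gen3 : alg_indep (upd (vec3 X0 X1 W) i1 Y)
  /\ generates (invs (A ++ B)) (upd (vec3 X0 X1 W) i1 Y).
Proof.
have [i2' g2] := gen2.
have EY : \prod_(w <- [seq X1 + u | u <- Ua]) w = Y by rewrite big_map /Y horner_nullpoly.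
rewrite -EY; apply: (orbit_step i2' g2).
- by rewrite map_inj_uniq //; apply: addrI.
- by apply/mapP; exists 0; rewrite ?addr0.
- move=> _ /mapP[_ /mapP[a _ ->] ->]; exists (a *: X0).
    by apply: avoids_Z; apply: avoids_X.
  by rewrite linearZ /= substX.
- move=> _ /mapP[_ /mapP[a aA ->] ->]; pose g : triple := (a, 0, lift_a a).
  have gB : g \in A ++ B by rewrite mem_cat inB /gb eqxx lift_aP ?orbT.
  exists (vec3 X0 (X1 + ga g *: X0) (X2 + dispX2 g)) => [|x].
    rewrite -!/(act g _); split=> [|j]; first by rewrite [act _ _]actX1.
    by move: j; apply: I3_ind => // _; [apply: actX0 | apply: WAB].
  by rewrite -/(act g x); case=> [|->]; [apply | rewrite EY YAB].
- by move=> x Bx g gA; apply: Bx; rewrite mem_cat gA.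
rewrite EY => Q; apply: invs_subst; apply: I3_ind => g gAB.
- by rewrite upd_neq // [LHS]actX0.
- by rewrite upd_eq YAB.
by rewrite upd_neq // [LHS]WAB.
Qed.

Hypothesis fac : factored G.

Let invsAB x : invs (A ++ B) x <-> invs G x.
Proof.
split=> xI g gG; last first.
  by apply: xI; move: gG; rewrite mem_cat inA inB => /orP[] /andP[].
have [c hG] := fac gG; set h := (0, gb g, c) in hG.
have hA : h \in A ++ B by rewrite mem_cat inA hG /ga eqxx.
have kB : gmul g (ginv h) \in A ++ B.
  by rewrite mem_cat inB GM ?GV // /gb /= subrr eqxx orbT.
have <- : gmul (gmul g (ginv h)) h = g.
  by rewrite /gmul /ginv /h; case: (g) => [[a b] d]; rewrite /ga /gb /gc /=; congr (_, _, _); ring.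
by rewrite -act_mul (xI h) // xI.
Qed.

Let homP : P \is (size A).-homog for mdeg.
Proof.
have nCA : (cardC <= size A)%N by apply: count_size.
have aC := size_aa_le A_mixed.
have -> : size A = (cardC - (size aa).-1 + 0 + (size A - cardC) + (size aa).-1)%N.
  rewrite addn0 -addnA [(_ - cardC + _)%N]addnC addnA subnK ?subnKC //.
  exact: leq_trans (leq_pred _) aC.
have homX0 b : b *: X0 \is 1.-homog for mdeg by apply: dhomogZ; apply: homog_X.
apply: homog_sum_seq => a aA; apply: dhomogM; last first.
  rewrite prod_butE -(count_but_one Uaa aA) -[X in X.-homog]mul1n; apply: homog_prod_seq => b _.
  by apply: rpredD; [apply: homog_X | apply: homX0].
apply: dhomogM; last first.
  have -> : (size A - cardC = count (fun g => gb g != 0%R) A)%N.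
    by rewrite -(count_predC (fun g => gb g == 0) A) addKn.
  rewrite -[X in X.-homog]mul1n; apply: homog_prod_seq => g _.
  apply: rpredD; first exact: homX0.
  by apply: rpredD; apply: dhomogZ; apply: homog_X.
apply: dhomogM.
  by have := dhomogMn (cardC - (size aa).-1) (@homog_X F 3 i0); rewrite mul1n.
by rewrite -[_%:MP]mulr1 mul_mpolyC; apply/dhomogZ/dhomog1.
Qed.

Lemma invariants_mixed : exists t : 'I_3 -> R,
  [/\ forall i, exists d, t i \is d.-homog for mdeg, alg_indep t & generates (invs G) t].
Proof.
have [ti tg] := gen3; exists (upd (vec3 X0 X1 W) i1 Y); split=> //.
  apply: I3_ind.
  - by rewrite upd_neq //; exists 1%N; apply: homog_X.
  - rewrite upd_eq; exists (1 * count predT Ua)%N.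
    rewrite /Y horner_nullpoly; apply: homog_prod_seq => _ /mapP[a _ ->].
    by apply: rpredD; [|apply: dhomogZ]; apply: homog_X.
  - rewrite upd_neq //; exists (size A); apply: rpredD.
      by apply: homL; apply: homog_X.
    by apply: dhomogZ; apply: homP.
by move=> x; rewrite -invsAB; apply: tg.
Qed.

End MixedGroup.

(** * Groups of translations by multiples of X0 *)

Section TranslationGroup.
Variables (F : fieldType) (p : nat).
Hypothesis charF : p \in [pchar F].
Local Notation R := {mpoly F[3]}.
Local Notation X0 := (X0 F).
Local Notation X1 := (X1 F).
Local Notation X2 := (X2 F).
Local Notation triple := (triple F).

Definition translates (d : nat) (u : R) :=
  forall g : triple, gb g = 0 -> exists c, act g u = u + c *: X0 ^+ d.

(** The invariant of the Euclidean algorithm.  Every translation, not only those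
    in K, has to move u and v by multiples of powers of X0, as the elements
    that are still to be added act on the generators found so far. *)
Definition transl_gens (K : seq triple) (i j : nat) (u v : R) :=
  [/\ u \is (p ^ i).-homog for mdeg /\ v \is (p ^ j).-homog for mdeg,
      translates (p ^ i) u /\ translates (p ^ j) v,
      alg_indep (vec3 X0 u v) & generates (invs K) (vec3 X0 u v)].

Lemma subst_vec3_swap (u v : R) Q :
  subst (vec3 X0 u v) Q = subst (vec3 X0 v u) (subst (vec3 X0 X2 X1) Q).
Proof.
rewrite subst_subst; apply: subst_ext; apply: I3_ind; rewrite /vec3 /=.
- by rewrite substX.
- by rewrite substX.
- by rewrite substX.
Qed.

Lemma transl_gens_swap K i j u v : transl_gens K i j u v -> transl_gens K j i v u.
Proof.
move=> [[hu hv] [tu tv] ti tg]; split=> // [Q|x].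
  rewrite subst_vec3_swap => /ti EQ; rewrite -[Q]subst_id.
  have -> : subst (fun i => 'X_i) Q = subst (vec3 X0 X2 X1) (subst (vec3 X0 X2 X1) Q).
    by rewrite -subst_vec3_swap; apply: subst_ext; apply: I3_ind.
  by rewrite EQ raddf0.
by rewrite tg; split=> -[Q ->]; exists (subst (vec3 X0 X2 X1) Q); rewrite subst_vec3_swap.
Qed.

(** Raising to a power of p is additive, so u raised to the power p^(j-i) is moved by a
    multiple of the same power of X0 as v. *)
Lemma transl_gens_triangular K i j u v c : (i <= j)%N ->
  transl_gens K i j u v -> transl_gens K i j u (v + c *: u ^+ (p ^ (j - i))).
Proof.
move=> ij [[hu hv] [tu tv] ti tg].
have Eij : (p ^ i * p ^ (j - i) = p ^ j)%N by rewrite -expnD subnKC.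
have pn : [pchar R].-nat (p ^ (j - i))%N.
  by rewrite pnatX (pnatE _ (pcharf_prime charF)) pchar_mpoly.
pose w : R := c *: X1 ^+ (p ^ (j - i)).
have fw : avoids i2 w by apply/avoids_Z/avoids_Xn/avoids_X.
have [] := triangular_change fw ti tg.
have E : upd (vec3 X0 u v) i2 (vec3 X0 u v i2 + subst (vec3 X0 u v) w)
    =1 vec3 X0 u (v + c *: u ^+ (p ^ (j - i))).
  by apply: I3_ind; rewrite ?upd_eq ?upd_neq // linearZ rmorphXn /= substX.
move=> ti' tg'; split.
- by split=> //; apply: rpredD => //; apply: dhomogZ; rewrite -Eij; apply: dhomogMn.
- split=> // g g0; have [a Ea] := tu g g0; have [b Eb] := tv g g0.
  exists (b + c * a ^+ (p ^ (j - i))).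
  rewrite linearD linearZ rmorphXn /= Ea Eb exprDn_pchar // exprZn -exprM Eij.
  by rewrite !scalerDr scalerA scalerDl addrACA.
- by move=> Q EQ; apply: ti'; rewrite (subst_ext E).
by move=> x; rewrite tg'; split=> -[Q ->]; exists Q; rewrite (subst_ext E).
Qed.

Lemma natr_pchar_inj : {in [pred m | (m < p)%N] &, injective (fun m => m%:R : F)}.
Proof.
have W m m' : (m <= m')%N -> (m' < p)%N -> m%:R = m'%:R :> F -> m = m'.
  move=> le lt E; have : (p %| m' - m)%N.
    by rewrite (dvdn_pcharf charF) natrB // E subrr.
  have [/eqP|pos] := posnP (m' - m).
    by rewrite subn_eq0 => le' _; apply/eqP; rewrite eqn_leq le.
  by move=> /(dvdn_leq pos); rewrite leqNgt (leq_ltn_trans (leq_subr _ _) lt).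
move=> m m' mp m'p E; case/orP: (leq_total m m') => le; first exact: W.
by apply/esym/W.
Qed.

(** An element g that fixes v and moves u by s has the orbit u + m s, for m
    below p; the product of this orbit replaces u.  Its displacement under any other
    translation is the value of an additive polynomial, so the product is again of
    the required form. *)
Section CyclicStep.
Variables (K : seq triple) (i j : nat) (u v : R) (g : triple) (al : F).
Hypotheses (tuv : transl_gens K i j u v) (al0 : al != 0).
Hypotheses (gu : act g u = u + al *: X0 ^+ (p ^ i)) (gv : act g v = v).

Let s : R := al *: X0 ^+ (p ^ i).
Let U : seq R := [seq m%:R *: s | m <- iota 0 p].
Let p_gt0 : (0 < p)%N. Proof. exact/prime_gt0/(pcharf_prime charF). Qed.

Let act_s h : act h s = s.
Proof. by rewrite /s linearZ rmorphXn /= actX0. Qed.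

Let s0 : s != 0.
Proof. by rewrite scaler_eq0 negb_or al0 expf_neq0 // X0_neq0. Qed.

Let UU : uniq U.
Proof.
rewrite map_inj_in_uniq ?iota_uniq // => m m'; rewrite !mem_iota !add0n /= => mp m'p.
by move=> /eqP; rewrite -subr_eq0 -scalerBl scaler_eq0 (negPf s0) orbF subr_eq0 =>
  /eqP /natr_pchar_inj->.
Qed.

Let mU m : m%:R *: s \in U.
Proof.
apply/mapP; exists (m %% p)%N; first by rewrite mem_iota ltn_mod.
congr (_ *: _); rewrite {1}(divn_eq m p) natrD natrM (pcharf0 charF).
by rewrite mulr0 add0r.
Qed.

Let UD : {in U &, forall x y, x + y \in U}.
Proof. by move=> _ _ /mapP[m _ ->] /mapP[m' _ ->]; rewrite -scalerDl -natrD mU. Qed.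

Let U0 : 0 \in U. Proof. by have := mU 0; rewrite scale0r. Qed.

Let N := (nullpoly U).[u].

Let LU h x : act h (nullpoly U).[x] = (nullpoly U).[act h x].
Proof.
rewrite !horner_nullpoly rmorph_prod /= !big_map; apply: eq_bigr => m _.
by rewrite linearD linearZ /= act_s.
Qed.

Let gpow m := iter m (gmul g) (gone F).

Let act_gpow m x : act (gpow m) x = iter m (act g) x.
Proof. by elim: m => [|m IH]; rewrite ?act_one //= -act_mul IH. Qed.

Let gN : act g N = N.
Proof.
rewrite /N LU gu -/s nullpoly_shift // => x xU.
by apply: UD => //; have := mU 1; rewrite scale1r.
Qed.

Lemma cyclic_step : exists u', transl_gens (g :: K) i.+1 j u' v.
Proof.
have [[hu hv] [tu tv] ti tg] := tuv; exists N.
have Kx h x : h \in K -> (exists Q, x = subst (vec3 X0 u v) Q) -> act h x = x.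
  by move=> hK /tg; apply.
have EN : \prod_(w <- [seq u + x | x <- U]) w = N by rewrite big_map /N horner_nullpoly.
have E : upd (vec3 X0 u v) i1 N =1 vec3 X0 N v.
  by apply: I3_ind; rewrite ?upd_eq ?upd_neq.
have [||||||ti' tg'] := @orbit_step _ _ (invs K) (invs (g :: K)) (vec3 X0 u v) i1
  [seq u + x | x <- U] ti tg.
- by rewrite map_inj_uniq //; apply: addrI.
- by apply/mapP; exists 0; rewrite ?addr0.
- move=> _ /mapP[_ /mapP[m _ ->] ->]; exists (m%:R *: (al *: X0 ^+ (p ^ i))).
    by do 2!apply: avoids_Z; apply: avoids_Xn; apply: avoids_X.
  by rewrite !linearZ rmorphXn /= substX.
- move=> _ /mapP[_ /mapP[m _ ->] ->].
  exists (vec3 X0 (X1 + ga (gpow m) *: X0) (X2 + dispX2 (gpow m))) => [|x Bx].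
    rewrite -!/(act (gpow m) _) !act_gpow; split=> [|k].
      elim: m => [|m IH] /=; first by rewrite scale0r addr0.
      rewrite IH linearD linearZ /= act_s gu -/s -addrA.
      by rewrite -[m.+1%:R]natr1 scalerDl scale1r [s + _]addrC.
    move: k; apply: I3_ind => // _; rewrite -/(act (gpow m) _) act_gpow.
      by elim: m => //= m ->; apply: actX0.
    by elim: m => //= m ->; apply: gv.
  rewrite -/(act (gpow m) x) act_gpow.
  have gx : act g x = x.
    by case: Bx => [Bx|->]; [apply: Bx; apply: mem_head | rewrite EN gN].
  by elim: m => //= m ->.
- by move=> x Bx h hK; apply: Bx; rewrite inE hK orbT.
- rewrite EN => Q; rewrite (subst_ext E); apply: invs_subst.
  apply: I3_ind => h; rewrite inE => /orP[/eqP->|hK].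
  + exact: actX0.
  + exact: actX0.
  + exact: gN.
  + rewrite /vec3 /= /N LU Kx //; exists 'X_i1; by rewrite substX.
  + exact: gv.
  + by apply: Kx => //; exists 'X_i2; rewrite substX.
rewrite EN in ti' tg'; split.
- split=> //; rewrite /N horner_nullpoly expnSr -{2}(size_iota 0 p).
  rewrite -(size_map (fun m => m%:R *: s)) -/U -count_predT.
  apply: homog_prod_seq => _ /mapP[m _ ->]; apply: rpredD => //; do 2!apply: dhomogZ.
  by have := dhomogMn (p ^ i) (@homog_X F 3 i0); rewrite mul1n.
- split=> // h h0; have [b Eb] := tu h h0.
  exists (\prod_(m <- iota 0 p) (b + m%:R * al)).
  rewrite /N LU Eb nullpoly_additive //; congr (_ + _).
  rewrite horner_nullpoly big_map (eq_bigr (fun m => (b + m%:R * al)%:MP * X0 ^+ (p ^ i))).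
    rewrite big_split /= prod_const_count count_predT size_iota -exprM -expnSr.
    by rewrite -rmorph_prod mul_mpolyC.
  by move=> m _; rewrite scalerA -scalerDl mul_mpolyC.
- by move=> Q EQ; apply: ti'; rewrite (subst_ext E).
by move=> x; rewrite tg'; split=> -[Q ->]; exists Q; rewrite (subst_ext E).
Qed.

End CyclicStep.

Lemma invariants_translations (K : seq triple) : (forall g, g \in K -> gb g = 0) ->
  exists i j u v, transl_gens K i j u v.
Proof.
elim: K => [|g K IH] Kb.
  exists 0%N, 0%N, X1, X2; rewrite /transl_gens expn0; split.
  - by split; apply: homog_X.
  - split=> g g0; first by exists (ga g); rewrite actX1.
    by exists (gc g); rewrite actX2 /dispX2 g0 scale0r add0r.
  - move=> Q <-; rewrite -[LHS]subst_id; apply: subst_ext; exact: I3_ind.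
  move=> x; split=> // _; exists x; rewrite -[LHS]subst_id; apply: subst_ext; exact: I3_ind.
have [|i [j [u [v tuv]]]] := IH; first by move=> h hK; apply: Kb; rewrite inE hK orbT.
wlog ij : i j u v tuv / (i <= j)%N.
  move=> W; case/orP: (leq_total i j) => le; first exact: (W i j u v).
  exact: (W j i v u (transl_gens_swap tuv) le).
have g0 : gb g = 0 by apply: Kb; apply: mem_head.
have [_ [tu tv] _ _] := tuv; have [a Ea] := tu g g0; have [b Eb] := tv g g0.
have [a0|a0] := eqVneq a 0.
  have [b0|b0] := eqVneq b 0.
    exists i, j, u, v; have [hh tt ti tg] := tuv; split=> // x.
    split=> [Kx|[Q ->]]; first by apply: (iffLR (tg x)) => h hK; apply: Kx; rewrite inE hK orbT.
    apply: invs_subst => k h; rewrite inE => /orP[/eqP->|hK].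
      move: k; apply: I3_ind; rewrite /vec3 /= ?actX0 //.
        by rewrite Ea a0 scale0r addr0.
      by rewrite Eb b0 scale0r addr0.
    suff /tg : exists Q, vec3 X0 u v k = subst (vec3 X0 u v) Q by apply.
    by exists 'X_k; rewrite substX.
  have [|u' tu'] := @cyclic_step K j i v u g b (transl_gens_swap tuv) b0 Eb.
    by rewrite Ea a0 scale0r addr0.
  by exists j.+1, i, u', u.
(* The Euclidean step: with this c, the element g fixes v + c u^(p^(j-i)). *)
pose c := - (b / a ^+ (p ^ (j - i))).
have tuv' := transl_gens_triangular c ij tuv.
have [|u' tu'] := @cyclic_step K i j u _ g a tuv' a0 Ea.
  rewrite actD actZ actXn Ea Eb exprDn_pchar; last first.
    by rewrite pnatX (pnatE _ (pcharf_prime charF)) pchar_mpoly.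
  rewrite exprZn -exprM -expnD subnKC // scalerDr scalerA mulNr divfK ?expf_neq0 //.
  by rewrite (scaleNr b) addrACA subrr addr0.
by exists i.+1, j, u', (v + c *: u ^+ (p ^ (j - i))).
Qed.

End TranslationGroup.

(** * The criterion for groups of unitriangular substitutions *)

Section Core.
Variables (F : fieldType) (p : nat).
Hypothesis charF : p \in [pchar F].
Local Notation R := {mpoly F[3]}.
Local Notation X0 := (X0 F).
Local Notation X1 := (X1 F).
Local Notation X2 := (X2 F).
Local Notation triple := (triple F).

Theorem factored_polynomial (G : seq triple) : ugroup G -> factored G ->
  exists t : 'I_3 -> R,
    [/\ forall i, exists d, t i \is d.-homog for mdeg, alg_indep t & generates (invs G) t].
Proof.
move=> ugG fac; have [/hasP[g gG gb0]|/hasPn noA] := boolP (has (fun g => gb g != 0) G).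
  apply: invariants_mixed => //; have [c cG] := fac g gG.
  by exists (0, gb g, c) => //; rewrite mem_undup mem_filter cG /ga eqxx.
have [|i [j [u [v [[hu hv] _ ti tg]]]]] := invariants_translations charF (K := G).
  by move=> g /noA; rewrite negbK => /eqP.
exists (vec3 X0 u v); split=> //; apply: I3_ind.
- by exists 1%N; apply: homog_X.
- by exists (p ^ i)%N.
- by exists (p ^ j)%N.
Qed.

(** A divisor E of c X0^e that does not vanish at some point with X0 = 0 is prime
    to X0, hence a nonzero constant. *)
Lemma monomial_divisor_eval_neq0 (E K : R) (c : F) (e : nat) (v w : 'I_3 -> F) :
  c != 0 -> E * K = c *: X0 ^+ e -> v i0 = 0 -> E.@[v] != 0 -> E.@[w] != 0.
Proof.
move=> c0 + v0 Ev; elim: e K => [|e IH] K EK.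
  have /(congr1 (meval w)) := EK; rewrite mevalM mevalZ expr0 meval1 mulr1 => Ew.
  by apply: contra_neq c0 => E0; rewrite -Ew E0 mul0r.
have [Q EQ] := subst_at_factor i0 0 E; have [Q' EQ'] := subst_at_factor i0 0 K.
have kE : subst_at i0 0 E != 0.
  apply: contra_neq Ev => kE0; rewrite kE0 !subr0 in EQ.
  by rewrite EQ mevalM mevalXU v0 mulr0.
have kK : subst_at i0 0 K = 0.
  apply: (mulfI kE); rewrite mulr0.
  have /(congr1 (subst_at i0 0)) := EK; rewrite {1}/subst_at substM -!/(subst_at _ _ _) => ->.
  by rewrite /subst_at linearZ rmorphXn /= -/(subst_at _ _ _) subst_atX expr0n scaler0.
rewrite kK !subr0 in EQ'; apply: (IH Q').
apply: (mulIf (X0_neq0 F)); rewrite -mulrA -[Q' * _]EQ' EK exprSr.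
by rewrite -scalerAl.
Qed.

Lemma act_eval0 (g : triple) (x : R) : (act g x).@[fun=> 0] = x.@[fun=> 0].
Proof.
elim/mpoly_alg_ind: x => [c|i|x y Ex Ey|x y Ex Ey].
- by rewrite /act substC.
- rewrite /act substX mevalXU; move: i; apply: I3_ind; rewrite /vec3 /dispX2 /=;
  by rewrite ?mevalD ?mevalZ !mevalXU ?mulr0 ?addr0.
- by rewrite actD !mevalD Ex Ey.
- by rewrite /act substM !mevalM Ex Ey.
Qed.

Section Converse.
Variable G : seq triple.
Hypothesis ugG : ugroup G.

Let G0 : gone F \in G. Proof. by case: ugG. Qed.
Let GM g h : g \in G -> h \in G -> gmul g h \in G. Proof. by case: ugG => _ + _; apply. Qed.
Let GV g : g \in G -> ginv g \in G. Proof. by case: ugG => _ _; apply. Qed.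

(** Orbits of pairs, rather than of x alone, let each point of the orbit of x carry
    the corresponding conjugate of y. *)
Definition orbit_pairs (x y : R) := undup [seq (act g x, act g y) | g <- G].
Definition orbit_disc (x y : R) := \prod_(o <- orbit_pairs x y | o != (x, y)) (x - o.1).

Lemma mem_orbit_pairs x y : (x, y) \in orbit_pairs x y.
Proof. by rewrite mem_undup; apply/mapP; exists (gone F); rewrite ?act_one. Qed.

Lemma orbit_disc_neq0 x y : (forall g, g \in G -> act g x = x -> act g y = y) ->
  orbit_disc x y != 0.
Proof.
move=> xy; rewrite /orbit_disc prodf_seq_neq0; apply/allP => o.
rewrite mem_undup => /mapP[g gG ->]; apply/implyP; apply: contra => /=.
by rewrite subr_eq0 => /eqP Ex; rewrite -Ex (xy g) // -Ex.
Qed.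

Lemma orbit_row m (f : 'I_m -> R) x y : generates (invs G) f ->
  exists B : 'I_m -> R, forall i, orbit_disc x y ^+ p * y^`M(i) = \sum_l B l * (f l)^`M(i).
Proof.
move=> gf.
pose K (s : 'I_3 -> R) := exists2 g, g \in G & s = vec3 X0 (X1 + ga g *: X0) (X2 + dispX2 g).
apply: (@jacobian_row F p 3 charF m K f (orbit_pairs x y) x y).
- move=> z Kz; apply/gf => g gG; apply: Kz; by exists g.
- by move=> _ [g _ ->]; apply: act_inj.
- exact: undup_uniq.
- exact: mem_orbit_pairs.
move=> _ o [g gG ->]; rewrite !mem_undup => /mapP[h hG ->] /=.
by apply/mapP; exists (gmul g h); rewrite ?GM // -!act_mul.
Qed.

Definition jac m (f : 'I_m -> R) : 'M[R]_(m, 3) := \matrix_(l, i) (f l)^`M(i).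

Lemma orbit_rows m (f : 'I_m -> R) k (x y : 'I_k -> R) : generates (invs G) f ->
  exists B : 'M[R]_(k, m),
    diag_mx (\row_j orbit_disc (x j) (y j) ^+ p) *m jac y = B *m jac f.
Proof.
move=> gf.
have [B EB] := @fin_all_exists 'I_k (fun=> 'I_m -> R) (fun j B => forall i,
   orbit_disc (x j) (y j) ^+ p * (y j)^`M(i) = \sum_l B l * (f l)^`M(i))
   (fun j => orbit_row (x j) (y j) gf).
exists (\matrix_(j, l) B j l); apply/matrixP => j i.
rewrite mul_diag_mx !mxE EB; apply: eq_bigr => l _; by rewrite !mxE.
Qed.

Lemma jac_var : jac (fun j : 'I_3 => 'X_j) = 1%:M.
Proof. by apply/matrixP => j i; rewrite !mxE mderiv_var. Qed.

Lemma orbit_rows_var m (f : 'I_m -> R) : generates (invs G) f ->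
  exists (d : 'rV[R]_3) (B : 'M[R]_(3, m)), (\prod_j d 0 j != 0) /\ diag_mx d = B *m jac f.
Proof.
move=> gf; have [B] := orbit_rows (fun j : 'I_3 => 'X_j) (fun j : 'I_3 => 'X_j) gf.
rewrite jac_var mulmx1 => EB; exists (\row_j orbit_disc 'X_j 'X_j ^+ p), B; split=> //.
apply/prodf_neq0 => j _; rewrite mxE expf_neq0 //.
exact: orbit_disc_neq0.
Qed.

(** At least three generators are needed, since [orbit_rows_var] factors a
    diagonal matrix of rank 3 through the m rows of the Jacobian matrix of f. *)
Lemma generators_count m (f : 'I_m -> R) : alg_indep f -> generates (invs G) f -> m = 3.
Proof.
move=> fi gf; apply/eqP; rewrite eqn_leq (alg_indep_leq fi) /=.
have [d [B [d0 EB]]] := orbit_rows_var gf.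
have := mxrankM_maxr (map_mx (@tofrac R) B) (map_mx (@tofrac R) (jac f)).
rewrite -map_mxM -EB mxrank_unit => [|]; first by move/leq_trans; apply; apply: rank_leq_row.
rewrite unitmxE det_map_mx det_diag unitfE tofrac_eq0.
exact: d0.
Qed.

Lemma jac_neq0 (f : 'I_3 -> R) : generates (invs G) f -> \det (jac f) != 0.
Proof.
move=> gf; have [d [B [d0 EB]]] := orbit_rows_var gf.
apply: contra_neq d0 => J0; have /(congr1 determinant) := EB.
by rewrite det_diag det_mulmx J0 mulr0.
Qed.

(** The subgroup A B of G. *)
Let H := [seq g <- G | has (fun h => (ga h == 0) && (gb h == gb g)) G].

Let inH g : reflect (g \in G /\ exists c, (0, gb g, c) \in G) (g \in H).
Proof.
rewrite mem_filter; apply: (iffP andP) => [[/hasP[h hG /andP[/eqP a0 /eqP b0]] gG]|[gG [c cG]]].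
  by split=> //; exists (gc h); rewrite -a0 -b0; case: (h) hG => [[]].
by split=> //; apply/hasP; exists (0, gb g, c) => //; rewrite /ga /gb /= !eqxx.
Qed.

Let ugH : ugroup H.
Proof.
split.
- by apply/inH; split=> //; exists 0.
- move=> g h /inH[gG [c cG]] /inH[hG [c' cG']]; apply/inH; split; first exact: GM.
  by exists (c + c' + 0 * gb h); have := GM cG cG'; rewrite /gmul /= addr0.
move=> g /inH[gG [c cG]]; apply/inH; split; first exact: GV.
by exists (- c + 0 * gb g); have := GV cG; rewrite /ginv /= oppr0.
Qed.

Let facH : factored H.
Proof.
move=> g /inH[gG [c cG]]; exists c; apply/inH; split=> //.
by exists c.
Qed.

Let subHG g : g \in H -> g \in G. Proof. by move=> /inH[]. Qed.

Let ga0_H g : g \in G -> ga g = 0 -> g \in H.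
Proof.
move=> gG a0; apply/inH; split=> //; exists (gc g).
by rewrite -a0; case: (g) gG => [[]].
Qed.

Let gb0_H g : g \in G -> gb g = 0 -> g \in H.
Proof. by move=> gG b0; apply/inH; split=> //; exists 0; rewrite b0. Qed.

Let prod_monomial (I : eqType) (r : seq I) (Q : pred I) (D : I -> R) :
  (forall i, i \in r -> Q i -> exists2 c, c != 0 & exists e, D i = c *: X0 ^+ e) ->
  exists2 c, c != 0 & exists e, \prod_(i <- r | Q i) D i = c *: X0 ^+ e.
Proof.
move=> mon; rewrite big_seq_cond; elim/big_rec: _ => [|i x /andP[ir Qi] [c c0 [e ->]]].
  by exists 1; rewrite ?oner_neq0 //; exists 0%N; rewrite scale1r expr0.
have [c' c'0 [e' ->]] := mon i ir Qi.
exists (c' * c); first exact: mulf_neq0.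
by exists (e' + e)%N; rewrite -scalerAl -scalerAr scalerA exprD.
Qed.

(** The differences X1 - g X1 are multiples of X0; elements that fix X1 lie in A,
    hence fix y. *)
Let disc_X1 (y : R) : invs H y ->
  exists2 c, c != 0 & exists e, orbit_disc X1 y ^+ p = c *: X0 ^+ e.
Proof.
move=> Hy; rewrite /orbit_disc -prodrXl; apply: prod_monomial => o.
rewrite mem_undup => /mapP[g gG ->] oE.
have a0 : ga g != 0.
  apply: contra_neq oE => a0; rewrite Hy; last exact: ga0_H.
  by rewrite actX1 a0 scale0r addr0.
exists ((- ga g) ^+ p); first by rewrite expf_neq0 // oppr_eq0.
by exists p; rewrite /= actX1 opprD addrA subrr add0r -scaleNr exprZn.
Qed.

(** The orbit product T of X2 under B is not affected by B; modulo X0 it is a power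
    of X2, which an element with b <> 0 maps to a power of X2 + b X1. *)
Let cB := undup [seq gc g | g <- G & gb g == 0].
Let T := (nullpoly [seq c *: X0 | c <- cB]).[X2].

Let cB_add : {in cB &, forall c d, c + d \in cB}.
Proof.
move=> c d; rewrite !mem_undup => /mapP[g] /[!mem_filter] /andP[/eqP gb0 gG] ->.
move=> /mapP[h] /[!mem_filter] /andP[/eqP hb0 hG] ->.
apply/mapP; exists (gmul g h); last by rewrite /gmul /gc /= hb0 mulr0 addr0.
by rewrite mem_filter GM // /gb /= -!/(gb _) gb0 hb0 addr0 eqxx.
Qed.

Let act_T g : act g T = \prod_(c <- cB) (X2 + gb g *: X1 + (c + gc g) *: X0).
Proof.
rewrite /T horner_nullpoly rmorph_prod /= big_map; apply: eq_bigr => c _.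
by rewrite actD actZ actX0 actX2 /dispX2 scalerDl [c *: X0 + _]addrC !addrA.
Qed.

Let T_fixed g : g \in G -> gb g = 0 -> act g T = T.
Proof.
move=> gG b0; rewrite act_T /T horner_nullpoly big_map b0.
have gcc : gc g \in cB by rewrite mem_undup; apply/mapP; exists g; rewrite // mem_filter b0 eqxx.
rewrite -[RHS](perm_big _ (perm_shift (undup_uniq _) (fun c cC => cB_add cC gcc))) big_map.
by apply: eq_bigr => c _; rewrite scale0r addr0.
Qed.

(** At this point X0 = X2 = 0, so T vanishes there while g T takes the value of a
    power of b. *)
Let v : 'I_3 -> F := vec3 0 1 0.

Let T_eval g : (act g T).@[v] = gb g ^+ size cB.
Proof.
rewrite act_T rmorph_prod /= -count_predT -prod_const_count; apply: eq_bigr => c _.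
by rewrite !mevalD !mevalZ !mevalXU /v /vec3 /= !mulr0 mulr1 add0r addr0.
Qed.

Let cB_gt0 : (0 < size cB)%N.
Proof.
suff : 0 \in cB by case: (cB).
by rewrite mem_undup; apply/mapP; exists (gone F); rewrite // mem_filter eqxx.
Qed.

Let disc_T (y : R) : invs H y -> (orbit_disc T y ^+ p).@[v] != 0.
Proof.
move=> Hy; rewrite rmorphXn expf_neq0 //= rmorph_prod prodf_seq_neq0 /=.
apply/allP => o; rewrite mem_undup => /mapP[g gG ->]; apply/implyP => oE.
have b0 : gb g != 0.
  by apply: contra_neq oE => b0; rewrite T_fixed // Hy //; apply: gb0_H.
rewrite mevalB T_eval -[T]act_one T_eval expr0n -(prednK cB_gt0) /= sub0r oppr_eq0.
exact: expf_neq0.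
Qed.

Let aa := undup [seq ga g | g <- G & gb g == 0].
Let Y := (nullpoly [seq a *: X0 | a <- aa]).[X1].

Let aaP a : reflect (exists c, (a, 0, c) \in G) (a \in aa).
Proof.
rewrite mem_undup; apply: (iffP mapP) => [[g]|[c acG]].
  rewrite mem_filter => /andP[/eqP gb0 gG] ->; exists (gc g).
  by move: gG gb0; case: g => [[a' b] c'] /[swap]; rewrite /gb /= => ->.
by exists (a, 0, c) => //; rewrite mem_filter acG /gb eqxx.
Qed.

Let split_a g : g \in G -> (ga g \in aa) = (g \in H).
Proof.
move=> gG; apply/aaP/inH => [[c cG]|[_ [c cG]]].
  split=> //; exists (- c + gc g - ga g * gb g); have := GM (GV cG) gG.
  congr (_ \in G); rewrite /gmul /ginv; case: (g) => [[x y] z].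
  by rewrite /ga /gb /gc /=; congr (_, _, _); ring.
exists (gc g - c - ga g * gb g); have := GM gG (GV cG).
congr (_ \in G); rewrite /gmul /ginv; case: (g) => [[x y] z].
by rewrite /ga /gb /gc /=; congr (_, _, _); ring.
Qed.

Let act_Y g : act g Y = \prod_(a <- aa) (X1 + (a + ga g) *: X0).
Proof.
rewrite /Y horner_nullpoly rmorph_prod /= big_map; apply: eq_bigr => a _.
by rewrite actD actZ actX0 actX1 scalerDl [a *: X0 + _]addrC !addrA.
Qed.

Let Y_inv : invs H Y.
Proof.
move=> g gH; rewrite act_Y /Y horner_nullpoly big_map.
have gaa : ga g \in aa by rewrite split_a ?subHG.
have aaD a : a \in aa -> a + ga g \in aa.
  move/aaP: gaa => [d dG] /aaP[c cG]; apply/aaP; exists (c + d).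
  by have := GM cG dG; rewrite /gmul /ga /gb /gc /= mulr0 !addr0.
by rewrite -[RHS](perm_big _ (perm_shift (undup_uniq _) aaD)) big_map.
Qed.

(** At X1 = 0 the polynomial Y vanishes; if g fixes Y, so does g Y, and
    this shows that the entry a of g is minus a value of a on B. *)
Let Y_stab g : g \in G -> act g Y = Y -> g \in H.
Proof.
move=> gG; rewrite -split_a // => /(congr1 (meval (vec3 1 0 0))).
have eval h : (act h Y).@[vec3 1 0 0] = \prod_(a <- aa) (a + ga h).
  rewrite act_Y rmorph_prod /=; apply: eq_bigr => a _.
  by rewrite mevalD mevalZ !mevalXU /vec3 /= mulr1 add0r.
rewrite -[in RHS](act_one Y) !eval [RHS](big_rem 0) /=; last by apply/aaP; exists 0.
rewrite addr0 mul0r => /eqP; rewrite prodf_seq_eq0 => /hasP[a aA /=].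
rewrite addrC addr_eq0 => /eqP->; move: aA => /aaP[c cG]; apply/aaP.
by exists (- c); have := GV cG; rewrite /ginv /ga /gb /gc /= mulr0 addr0 oppr0.
Qed.

(** E is the determinant of the derivative of f with respect to h.  By [orbit_rows]
    it divides the products of discriminants for theta = T and for theta = X1;
    the former keeps it from vanishing at a point with X0 = 0, the latter makes
    it a divisor of a power of X0.  So E does not vanish at the origin, where h and g h
    take the same value, and the difference quotient matrix Q between h and g h
    has a nonzero determinant although it annihilates the differences h - g h. *)
Theorem polynomial_factored (m : nat) (f : 'I_m -> R) :
  alg_indep f -> generates (invs G) f -> factored G.
Proof.
move=> fi gf g gG; suff /inH[] : g \in H by [].
have m3 := generators_count fi gf; subst m.
have [h [_ hi gh]] := factored_polynomial ugH facH.
have Hh k : invs H (h k) by apply/gh; exists 'X_k; rewrite substX.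
have [phi Ephi] : exists phi : 'I_3 -> {mpoly F[3]}, forall l, f l = subst h (phi l).
  apply: (@fin_all_exists 'I_3 (fun=> {mpoly F[3]}) (fun l P => f l = subst h P)) => l.
  apply/gh => k kH; have : invs G (f l) by apply/gf; exists 'X_l; rewrite substX.
  by apply; apply: subHG.
pose M := \matrix_(l, k) subst h (phi l)^`M(k); pose E := \det M.
have EW : jac f = M *m jac h.
  apply/matrixP => l i; rewrite !mxE Ephi mderiv_subst; apply: eq_bigr => k _.
  by rewrite !mxE.
have Jh0 : \det (jac h) != 0.
  have := jac_neq0 gf; rewrite EW det_mulmx mulf_eq0 negb_or => /andP[].
  by [].
have divE x : exists K, E * K = \prod_k orbit_disc x (h k) ^+ p.
  have [B EB] := orbit_rows (fun=> x) h gf; exists (\det B).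
  have /(congr1 determinant) := EB; rewrite det_mulmx det_diag EW !det_mulmx mulrA.
  move/(mulIf Jh0); rewrite [\det B * _]mulrC => <-.
  by apply: eq_bigr => k _; rewrite mxE.
have Ev : E.@[v] != 0.
  have [K EK] := divE T; have /(congr1 (meval v)) := EK.
  rewrite mevalM rmorph_prod /= => EKv.
  suff : E.@[v] * K.@[v] != 0 by rewrite mulf_eq0 negb_or => /andP[].
  by rewrite EKv; apply/prodf_neq0 => k _; apply: disc_T.
have E0 : E.@[fun=> 0] != 0.
  have [K EK] := divE X1.
  have [k _ _|c c0 [e Ece]] := @prod_monomial _ (index_enum 'I_3) xpredT
     (fun k => orbit_disc X1 (h k) ^+ p); first exact: disc_X1.
  apply: (@monomial_divisor_eval_neq0 E K c e v _ c0 _ _ Ev) => //.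
  by rewrite EK; exact: Ece.
have qex l : exists q : 'I_3 -> R, \sum_j q j * (h j - act g (h j)) = 0
    /\ forall j, (q j).@[fun=> 0] = (M l j).@[fun=> 0].
  have h0 j : (h j).@[fun=> 0] = (act g (h j)).@[fun=> 0] by rewrite act_eval0.
  have [q Eq q0] := subst_sub (phi l) h0; exists q; split=> [|j]; last by rewrite q0 mxE.
  have fl : invs G (f l) by apply/gf; exists 'X_l; rewrite substX.
  rewrite -Eq -act_subst -Ephi fl //; exact: subrr.
have [q Eq] := @fin_all_exists 'I_3 (fun=> 'I_3 -> R) _ qex.
pose Q := \matrix_(l, j) q l j.
have Q0 : \det Q != 0.
  apply: contra_neq E0 => /(congr1 (meval (fun=> 0))).
  rewrite raddf0 -det_map_mx => Q00; rewrite /E -det_map_mx -[RHS]Q00.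
  congr (\det _); apply/matrixP => l j.
  by rewrite !mxE [RHS](Eq l).2 mxE.
pose z := \col_j (h j - act g (h j)).
have Qz : Q *m z = 0.
  apply/matrixP => l j; rewrite !mxE -[RHS](Eq l).1; apply: eq_bigr => k _.
  by rewrite !mxE.
have gh_fix j : act g (h j) = h j.
  have : \det Q *: z = 0 by rewrite -mul_scalar_mx -mul_adj_mx -mulmxA Qz mulmx0.
  move=> /matrixP/(_ j 0); rewrite !mxE => /eqP; rewrite mulf_eq0 (negPf Q0) /=.
  by rewrite subr_eq0 eq_sym => /eqP.
apply: Y_stab => //; have /gh[P ->] := Y_inv.
by rewrite act_subst; apply: subst_ext.
Qed.

End Converse.
End Core.

(** * An invariant flag *)

(** The quotient module by U is nonzero, so the p-group fixes a nonzero vector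
    of it. *)
Lemma pgroup_fixed_mod (F : fieldType) (p : nat) (gT : finGroupType) (n : nat)
    (rG : mx_representation F [set: gT] n) (U : 'M[F]_n) :
  p \in [pchar F] -> p.-nat #|gT| -> mxmodule rG U -> ~~ row_full U ->
  exists2 v : 'rV[F]_n, ~~ (v <= U)%MS & forall x, (v *m rG x - v <= U)%MS.
Proof.
move=> charF pG modU nfull; set rU := factmod_repr modU.
have n0 : (0 < \rank (cokermx U))%N.
  by rewrite mxrank_coker subn_gt0 ltn_neqAle rank_leq_col andbT.
have pgG : (p.-group [set: gT])%g by rewrite /pgroup cardsT.
have := rfix_pgroup_pchar charF rU n0 pgG (subxx _).
case/rowV0Pn => w /rfix_mxP wfix w0.
have wE : in_factmod U (val_factmod w) = w by rewrite val_factmodK.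
exists (val_factmod w) => [|x]; first by rewrite -in_factmod_eq0 wE.
rewrite -in_factmod_eq0 linearB /= in_factmodJ ?inE // wE.
by rewrite [_ *m _]wfix ?inE // subrr.
Qed.

Import passmx.

Section Flag.
Variables (F : fieldType) (p : nat) (V : vectType F) (G : {fset 'End(V)}).
Hypotheses (charF : p \in [pchar F]) (pG : finite_pgroup p G).

Lemma GL_lker0 g : g \in G -> lker g == 0%VS.
Proof.
case: pG => -[GL _ _ _] _ /GL[h [_ hg]]; apply/lker0P => u v guv.
have hgE x : h (g x) = x by rewrite -comp_lfunE hg id_lfunE.
by rewrite -[u]hgE guv hgE.
Qed.

(** Row vectors make matrices act on the right, so the group law on G is
    composition in the opposite order. *)
Lemma fixed_mod_subspace (U : {vspace V}) :
    (forall g u, g \in G -> u \in U -> g u \in U) -> U != fullv ->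
  exists2 v, v \notin U & forall g, g \in G -> g v - v \in U.
Proof.
move=> GU Unfull; have [[_ G1 GM GV] pcard] := pG.
pose gt : finType := [the finType of fset_sub_type G].
pose one : gt := FSetSub G1.
pose mul (x y : gt) : gt := FSetSub (GM _ _ (fsvalP y) (fsvalP x)).
pose inv (x : gt) : gt := FSetSub (GV _ (fsvalP x)).
have mulA : associative mul.
  by move=> x y z; apply: val_inj; rewrite /= comp_lfunA.
have mul1 : left_id one mul by move=> x; apply: val_inj; rewrite /= comp_lfun1r.
have mulV : left_inverse one inv mul.
  by move=> x; apply: val_inj; rewrite /= lker0_compfV ?GL_lker0 ?fsvalP.
pose gTm := Finite_isGroup.Build gt mulA mul1 mulV.
pose gT : finGroupType := HB.pack gt gTm.
pose e := vbasis {:V}; have eB : basis_of {:V} e := vbasisP _.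
pose r (x : gT) := mxof e e (fsval (x : gt)).
have rP : mx_repr [set: gT] r.
  split=> [|x y _ _]; first by rewrite /r /= mxof1 // (basis_free eB).
  by rewrite /r /= (@mxof_comp _ _ _ _ e e e eB).
pose rG := MxRepresentation rP.
have UE u : (u \in U) = (rVof e u <= msof e U)%MS by rewrite rVof_sub // msofK.
have modU : mxmodule rG (msof e U).
  apply/mxmoduleP => x _; apply/rV_subP => w /submxP[a ->].
  have := GU (fsval (x : gt)) (vecof e (a *m msof e U)) (fsvalP _).
  rewrite mem_vecof // submxMl => /(_ isT); rewrite UE (@rVof_app _ _ _ e e eB) vecofK //.
  by rewrite mulmxA.
have nfull : ~~ row_full (msof e U).
  apply: contra Unfull => full; rewrite eqEsubv subvf /=; apply/subvP => u _.
  by rewrite UE submx_full.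
have pcard' : (p.-nat #|gT|)%N by move: pcard; rewrite cardfE.
have [w wU wfix] := @pgroup_fixed_mod _ p gT _ rG (msof e U) charF pcard' modU nfull.
exists (vecof e w) => [|g gG]; first by rewrite UE vecofK.
by have := wfix (FSetSub gG); rewrite UE linearB /= (@rVof_app _ _ _ e e eB) vecofK.
Qed.

End Flag.

(** * Coordinates adapted to the group *)

Section Transfer.
Variables (F : fieldType) (p : nat) (V : vectType F) (G : {fset 'End(V)}).
Hypotheses (charF : p \in [pchar F]) (pG : finite_pgroup p G) (dimV : \dim {:V} = 3%N).

Lemma unitriangular_basis : exists2 e : 3.-tuple V, basis_of {:V} e &
  forall g, g \in G -> exists a b c,
    [/\ g e`_0 = e`_0, g e`_1 = e`_1 + a *: e`_0
      & g e`_2 = e`_2 + (b *: e`_1 + c *: e`_0)].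
Proof.
have nfull (X : seq V) : (size X < 3)%N -> <<X>>%VS != fullv.
  move=> X3; apply: contraTneq X3 => E; rewrite -leqNgt -dimV -E; exact: dim_span.
have [||e0] := @fixed_mod_subspace F p V G charF pG <<[::]>>%VS.
- by move=> g u _; rewrite span_nil memv0 => /eqP->; rewrite linear0 mem0v.
- exact: nfull.
rewrite span_nil memv0 => e0n ge0.
have g0 g : g \in G -> g e0 = e0.
  by move=> /ge0; rewrite memv0 subr_eq0 => /eqP.
have [||e1 e1n ge1] := @fixed_mod_subspace F p V G charF pG <<[:: e0]>>%VS.
- by move=> g u gG; rewrite span_seq1 => /vlineP[k ->]; rewrite linearZ /= g0 // memvZ ?memv_line.
- exact: nfull.
have g1 g : g \in G -> exists a, g e1 = e1 + a *: e0.
  move=> /ge1; rewrite span_seq1 => /vlineP[a E]; exists a.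
  by rewrite -E addrC subrK.
have span2 u : u \in <<[:: e1; e0]>>%VS -> exists b c, u = b *: e1 + c *: e0.
  rewrite span_cons span_seq1 => /memv_addP[_ /vlineP[b ->] [_ /vlineP[c ->] ->]].
  by exists b, c.
have [||e2 e2n ge2] := @fixed_mod_subspace F p V G charF pG <<[:: e1; e0]>>%VS.
- move=> g u gG /span2[b [c ->]]; rewrite linearD !linearZ /= g0 //.
  have [a ->] := g1 g gG; rewrite scalerDr scalerA -addrA -scalerDl.
  by rewrite rpredD ?rpredZ ?memv_span ?inE ?eqxx ?orbT.
- exact: nfull.
exists [tuple e0; e1; e2] => [|g gG].
  rewrite basisEfree subvf dimV /= andbT.
  rewrite (@perm_free _ _ _ [:: e2; e1; e0]); last exact: (permEl (perm_rev [:: e2; e1; e0])).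
  by rewrite !free_cons nil_free e2n e1n span_nil memv0 e0n.
have [a Ea] := g1 g gG; have [b [c E]] := span2 _ (ge2 g gG).
exists a, b, c; split=> //; [exact: g0|].
by rewrite -E addrC subrK.
Qed.

Variable e : 3.-tuple V.
Hypothesis eB : basis_of {:V} e.
Hypothesis eG : forall g, g \in G -> exists a b c,
    [/\ g e`_0 = e`_0, g e`_1 = e`_1 + a *: e`_0
      & g e`_2 = e`_2 + (b *: e`_1 + c *: e`_0)].

Let co (i : 'I_3) (v : V) : F := coord e i v.

Definition params (g : 'End(V)) : triple F := (co i0 (g e`_1), co i1 (g e`_2), co i0 (g e`_2)).

Let coE i (j : 'I_3) : co i e`_j = (j == i)%:R.
Proof. by rewrite /co coord_free // (basis_free eB). Qed.

Let co_sum v : v = co i0 v *: e`_0 + (co i1 v *: e`_1 + co i2 v *: e`_2).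
Proof.
rewrite [LHS](coord_basis eB) ?memvf // !big_ord_recl big_ord0 addr0 /co.
have -> : ord0 = i0 by apply: val_inj.
have -> : lift i0 ord0 = i1 by apply: val_inj.
by have -> : lift i0 (lift ord0 ord0) = i2 by apply: val_inj.
Qed.

Let paramsP g : g \in G -> [/\ g e`_0 = e`_0, g e`_1 = e`_1 + ga (params g) *: e`_0
      & g e`_2 = e`_2 + (gb (params g) *: e`_1 + gc (params g) *: e`_0)].
Proof.
move=> /eG[a [b [c [E0 E1 E2]]]].
have c0 := coE ^~ i0; have c1 := coE ^~ i1; have c2 := coE ^~ i2.
rewrite /params E1 E2 /ga /gb /gc /= /co !linearD !linearZ /= -!/(co _ _) c0 !c1 !c2 /=.
by rewrite !(c0, eqxx, mulr1, mulr0, add0r, addr0).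
Qed.

Let lin_ext (f g : 'End(V)) : f e`_0 = g e`_0 -> f e`_1 = g e`_1 -> f e`_2 = g e`_2 -> f = g.
Proof.
move=> E0 E1 E2; apply/lfunP => v; rewrite [v]co_sum !linearD !linearZ /=.
by rewrite E0 E1 E2.
Qed.

Let GG : GLsubgroup (fun g => g \in G). Proof. by case: pG. Qed.
Let GM g h : g \in G -> h \in G -> (g \o h)%VF \in G. Proof. by case: GG => _ _ + _; apply. Qed.
Let GV g : g \in G -> (g^-1)%VF \in G. Proof. by case: GG => _ _ _; apply. Qed.
Let G1 : \1%VF \in G. Proof. by case: GG. Qed.

Let params_eq g a b c : g \in G -> g e`_1 = e`_1 + a *: e`_0 ->
  g e`_2 = e`_2 + (b *: e`_1 + c *: e`_0) -> params g = (a, b, c).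
Proof.
move=> gG E1 E2; have c0 := coE ^~ i0; have c1 := coE ^~ i1; have c2 := coE ^~ i2.
rewrite /params E1 E2 /co !linearD !linearZ /= -!/(co _ _) c0 !c1 !c2 /=.
by rewrite !(c0, eqxx, mulr1, mulr0, add0r, addr0).
Qed.

Let paramsM g h : g \in G -> h \in G -> params (g \o h)%VF = gmul (params g) (params h).
Proof.
move=> gG hG; move: (paramsP gG) (paramsP hG).
move: (params g) (params h) => [[a b] c] [[a' b'] c'] [g0 g1 g2] [h0 h1 h2].
rewrite /gmul; apply: params_eq; first exact: GM.
  by rewrite comp_lfunE h1 linearD linearZ /= g0 g1 -addrA -scalerDl.
rewrite comp_lfunE h2 !linearD !linearZ /= g0 g1 g2 -addrA; congr (_ + _).
rewrite /ga /gb /gc /= scalerDr scalerA !scalerDl -[_ + _ + c' *: _]addrA addrACA.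
by congr (_ + _); rewrite [_ + c' *: _]addrC addrA mulrC.
Qed.

Let params1 : params \1%VF = gone F.
Proof. by apply: params_eq; rewrite ?id_lfunE ?scale0r ?addr0. Qed.

Let compVg g : g \in G -> (g^-1 \o g = \1)%VF.
Proof. by move=> gG; apply: lker0_compVf; exact: (GL_lker0 pG gG). Qed.

Let paramsV g : g \in G -> params (g^-1)%VF = ginv (params g).
Proof.
move=> gG; have := paramsM (GV gG) gG; rewrite compVg // params1.
case: (params g) (params _) => [[a b] c] [[a' b'] c'].
rewrite /gmul /ginv /gone /ga /gb /gc /= => -[/esym/eqP + /esym/eqP].
rewrite addr_eq0 => /eqP->; rewrite addr_eq0 => /eqP-> /esym/eqP.
by rewrite -addrA addr_eq0 => /eqP->; congr (_, _, _); rewrite opprD mulNr opprK.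
Qed.

Definition Gparams : seq (triple F) := [seq params g | g <- enum_fset G].

Let GparamsP q : reflect (exists2 g, g \in G & q = params g) (q \in Gparams).
Proof. exact: mapP. Qed.

Lemma ugroup_Gparams : ugroup Gparams.
Proof.
split.
- by apply/GparamsP; exists \1%VF; rewrite ?params1.
- move=> _ _ /GparamsP[g gG ->] /GparamsP[h hG ->]; apply/GparamsP.
  by exists (g \o h)%VF; rewrite ?GM ?paramsM.
- by move=> _ /GparamsP[g gG ->]; apply/GparamsP; exists (g^-1)%VF; rewrite ?GV ?paramsV.
Qed.

Let subE (g : 'End(V)) v : (g - \1)%VF v = g v - v.
Proof. by rewrite add_lfunE opp_lfunE id_lfunE. Qed.

Lemma square_e2 g : g \in G ->
  ((g - \1) \o (g - \1))%VF e`_2 = (ga (params g) * gb (params g)) *: e`_0.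
Proof.
move=> gG; have [g0 g1 g2] := paramsP gG.
rewrite comp_lfunE !subE g2 [e`_2 + _]addrC addrK linearD !linearZ /= g0 g1.
by rewrite opprD addrACA subrr addr0 -scalerBr [e`_1 + _]addrC addrK scalerA mulrC.
Qed.

(** If b = 0 the image of g - 1 is contained in the line of e_0, and if a = 0 in
    the line of (g - 1) e_2. *)
Lemma elementary_transvection g : g \in G -> ga (params g) * gb (params g) = 0 ->
  g = \1%VF \/ transvection g.
Proof.
move=> gG ab0; have [->|g1n] := eqVneq g \1%VF; [by left | right].
have [g0 g1 g2] := paramsP gG; set s := (g - \1)%VF.
have s0 : s e`_0 = 0 by rewrite subE g0 subrr.
have s1 : s e`_1 = ga (params g) *: e`_0 by rewrite subE g1 addrC addKr.
have s2 : s e`_2 = gb (params g) *: e`_1 + gc (params g) *: e`_0 by rewrite subE g2 addrC addKr.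
have sn : s != 0 by rewrite subr_eq0.
have limg1 w : (limg s <= <[w]>)%VS -> \dim (limg s) = 1%N.
  move=> /dimvS; rewrite dim_vline => le; apply/eqP; rewrite eqn_leq.
  rewrite (leq_trans le (leq_b1 _)) lt0n dimv_eq0 /=.
  apply: contra sn => /eqP E; apply/eqP/lfunP => v; apply/eqP.
  by rewrite zero_lfunE -memv0 -E memv_img ?memvf.
have sE v : s v = co i1 v *: s e`_1 + co i2 v *: s e`_2.
  by rewrite {1}[v]co_sum !linearD !linearZ /= s0 scaler0 add0r.
split.
- by case: GG => GL _ _ _; apply: GL.
- have [b0|b0] := eqVneq (gb (params g)) 0.
    apply: (limg1 e`_0); apply/subvP => _ /memv_imgP[v _ ->].
    by rewrite sE s1 s2 b0 scale0r add0r !scalerA -scalerDl memvZ ?memv_line.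
  have a0 : ga (params g) = 0 by apply/eqP; move/eqP: ab0; rewrite mulf_eq0 (negPf b0) orbF.
  apply: (limg1 (s e`_2)); apply/subvP => _ /memv_imgP[v _ ->].
  by rewrite sE s1 a0 scale0r scaler0 add0r memvZ ?memv_line.
apply: lin_ext; rewrite ?zero_lfunE.
- by rewrite comp_lfunE s0 linear0.
- by rewrite comp_lfunE s1 linearZ /= s0 scaler0.
by rewrite square_e2 // ab0 scale0r.
Qed.

(** The elements g of G for which some (0, b, c) in the group has the same b as g form
    a subgroup.  It contains the transvections, as a b = 0 for them.  Conversely the
    two factors of g in A B are transvections or 1. *)
Lemma generated_factored : generated_by_transvections G <-> factored Gparams.
Proof.
split=> [[T Ttr TG]|fac].
  pose H (g : 'End(V)) := g \in G /\ exists c, (0, gb (params g), c) \in Gparams.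
  have [GL _ _ _] := GG; have [_ UM UV] := ugroup_Gparams.
  have HG : GLsubgroup H.
    split.
    - by move=> g [/GL].
    - split=> //; exists 0; rewrite params1; apply/GparamsP.
      by exists \1%VF; rewrite ?params1.
    - move=> g h [gG [c cG]] [hG [d dG]]; split; first exact: GM.
      exists (c + d + 0 * gb (params h)); rewrite paramsM //.
      by have := UM _ _ cG dG; rewrite /gmul /= addr0.
    - move=> g [gG [c cG]]; split; first exact: GV.
      exists (- c + 0 * gb (params g)); rewrite paramsV //.
      by have := UV _ cG; rewrite /ginv /= oppr0.
  have TH t : T t -> H t.
    move=> Tt; have tG : t \in G by apply/TG => K _; apply.
    split=> //; have [_ _ tt] := Ttr t Tt.
    have := square_e2 tG; rewrite tt zero_lfunE => /esym/eqP.
    have e0n : e`_0 != 0.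
      apply/eqP => E; have := coE i0 i0; rewrite E /co linear0 eqxx => /esym/eqP.
      by rewrite oner_eq0.
    rewrite scaler_eq0 (negPf e0n) orbF mulf_eq0 => /orP[/eqP a0|/eqP b0].
      exists (gc (params t)); apply/GparamsP; exists t => //.
      by case: (params t) a0 => [[a b] c]; rewrite /ga /gb /gc /= => ->.
    by exists 0; rewrite b0; apply/GparamsP; exists \1%VF; rewrite ?params1.
  by move=> _ /GparamsP[g /TG gen ->]; have [] := gen H HG TH.
exists (fun t => t \in G /\ transvection t) => [t []//|g].
split=> [gG H HG TH|gen]; last exact: (gen (fun h => h \in G) GG (fun t Tt => proj1 Tt)).
have [_ H1 HM HV] := HG.
have elem h : h \in G -> ga (params h) * gb (params h) = 0 -> H h.
  by move=> hG /(elementary_transvection hG)[->|tr] //; apply: TH.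
have [c /GparamsP[k kG Ek]] := fac _ (map_f params gG).
have -> : g = ((g \o k^-1) \o k)%VF by rewrite -comp_lfunA compVg // comp_lfun1r.
apply: HM; apply: elem; rewrite ?GM ?GV //; last by rewrite -Ek /ga /= mul0r.
by rewrite paramsM ?GV // paramsV // -Ek /gb /= subrr mulr0.
Qed.

Local Notation d := (\dim {:V}).
Local Notation R := {mpoly F[3]}.

(** The vectors of V as linear forms in three variables, in the basis adapted to G;
    [of_Sym] and [to_Sym] are the resulting isomorphisms between S(V) and the
    polynomial ring in three variables. *)
Definition coords (v : V) : R := \sum_k co k v *: 'X_k.

Fact coords_is_linear : linear coords.
Proof.
move=> a u v; rewrite /coords scaler_sumr -big_split; apply: eq_bigr => k _ /=.
by rewrite /co linearP scalerDl scalerA.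
Qed.

HB.instance Definition _ :=
  GRing.isLinear.Build F V R *:%R coords coords_is_linear.

Let t0 (k : 'I_3) : Sym V := Sym_inj e`_k.
Let s (i : 'I_d) : R := coords (vbasis {:V})`_i.

Let coords_e (k : 'I_3) : coords e`_k = 'X_k.
Proof.
rewrite /coords (bigD1 k) //= big1 => [|i ik]; first by rewrite coE eqxx scale1r addr0.
by rewrite coE eq_sym (negPf ik) scale0r.
Qed.

Let to_Sym : R -> Sym V := subst t0.
Let of_Sym : Sym V -> R := subst s.

Let of_Sym_inj v : of_Sym (Sym_inj v) = coords v.
Proof.
rewrite /of_Sym /Sym_inj linear_sum [in RHS](coord_vbasis (memvf v)) linear_sum.
by apply: eq_bigr => i _; rewrite !linearZ /= substX.
Qed.

Let to_Sym_j v : to_Sym (coords v) = Sym_inj v.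
Proof.
rewrite /to_Sym /coords linear_sum [in RHS](coord_basis eB (memvf v)) linear_sum.
by apply: eq_bigr => i _; rewrite !linearZ /= substX.
Qed.

Let of_SymK : cancel of_Sym to_Sym.
Proof.
move=> x; rewrite /of_Sym /to_Sym subst_subst -[RHS]subst_id; apply: subst_ext => i.
by rewrite -/(to_Sym _) to_Sym_j Sym_inj_basis.
Qed.

Let to_SymK : cancel to_Sym of_Sym.
Proof.
move=> x; rewrite /of_Sym /to_Sym subst_subst -[RHS]subst_id; apply: subst_ext => k.
by rewrite -/(of_Sym _) of_Sym_inj coords_e.
Qed.

Let act_coords g v : g \in G -> act (params g) (coords v) = coords (g v).
Proof.
move=> gG; rewrite [in LHS]/coords [in RHS](coord_basis eB (memvf v)) !linear_sum /=.
apply: eq_bigr => k _; rewrite actZ !linearZ /=; congr (_ *: _).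
have [g0 g1 g2] := paramsP gG.
have c0 := coords_e i0; have c1 := coords_e i1; have c2 := coords_e i2.
move: k; apply: I3_ind; rewrite -/(coords _).
- by rewrite [LHS]actX0 g0 c0.
- by rewrite [LHS]actX1 g1 linearD linearZ /= c0 c1.
by rewrite [LHS]actX2 g2 !linearD !linearZ /= c0 c1 c2.
Qed.

Let of_Sym_act g x : g \in G -> of_Sym (Sym_act g x) = act (params g) (of_Sym x).
Proof.
move=> gG; rewrite /Sym_act -(substE (fun i => Sym_inj (g (vbasis {:V})`_i))) /of_Sym.
rewrite subst_subst act_subst; apply: subst_ext => i.
by rewrite -/(of_Sym _) of_Sym_inj /s act_coords.
Qed.

Let invariantE x : Sym_invariant G x <-> invs Gparams (of_Sym x).
Proof.
split=> [Gx _ /GparamsP[g gG ->]|Gx g gG]; first by rewrite -of_Sym_act // Gx.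
by apply: (can_inj of_SymK); rewrite of_Sym_act // Gx // map_f.
Qed.

Lemma Sym_polynomialP :
  is_polynomial_ring (Sym_invariant G) <-> factored Gparams.
Proof.
split=> [[m [f [_ fi fg]]]|fac].
  have fE P : P \mPo f = subst (tnth f) P.
    by rewrite substE; congr (_ \mPo _); apply: eq_from_tnth => i; rewrite tnth_mktuple.
  have stE P : subst (fun i => of_Sym (tnth f i)) P = of_Sym (P \mPo f).
    by rewrite fE /of_Sym subst_subst.
  apply: (@polynomial_factored F p charF Gparams ugroup_Gparams m
    (fun i => of_Sym (tnth f i))) => [P|x].
    by rewrite stE => E; apply: fi; rewrite -[LHS]of_SymK E /to_Sym raddf0.
  rewrite -[x]to_SymK -invariantE fg; split=> -[P E]; exists P.
    by rewrite E stE.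
  by rewrite -[LHS]of_SymK E stE of_SymK.
have [t [th ti tg]] := factored_polynomial charF ugroup_Gparams fac.
exists 3%N, [tuple to_Sym (t i) | i < 3].
have fE P : P \mPo [tuple to_Sym (t i) | i < 3] = to_Sym (subst t P).
  by rewrite -substE /to_Sym subst_subst.
have t0h k : t0 k \is 1.-homog for mdeg.
  by apply: rpred_sum => i _; apply: dhomogZ; apply: homog_X.
split=> [i|P|x].
- by have [dg hg] := th i; exists dg; rewrite tnth_mktuple; apply: homog_subst.
- by rewrite fE => E; apply: ti; rewrite -[LHS]to_SymK E /of_Sym raddf0.
rewrite invariantE tg; split=> -[P E]; exists P; first by rewrite fE -E of_SymK.
by rewrite E fE to_SymK.
Qed.

End Transfer.

(** * Polynomial invariants and transvections *)

Theorem theoremA (F : fieldType) (p : nat) (charF : p \in [pchar F])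
    (V : vectType F) (dimV : \dim {:V} = 3%N)
    (G : {fset 'End(V)}) (pG : finite_pgroup p G) :
  is_polynomial_ring (Sym_invariant G) <-> generated_by_transvections G.
Proof.
have [e eB eG] := unitriangular_basis charF pG dimV.
by rewrite (generated_factored pG eB eG); exact: (Sym_polynomialP charF pG eB eG).
Qed.
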